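(* Let $(\bar M^7,\bar g,\phi)$ be a $\mathrm{G}_2$-manifold of class $\mathcal{W}_\alpha$, $\alpha\in\{1,2,3,4\}$, and let $M^6\subset\bar M^7$ be a hypersurface with unit normal $V$. Then $M^6$ carries the induced spin structure and induced $\mathrm{SU}(3)$-structure $\phi|_{M^6}$, whose class is determined by $\mathcal{W}_\alpha$ (column) and the Weingarten type of $M^6$ (row) as follows: $$\begin{array}{c|cccc} & \mathcal{W}_1 & \mathcal{W}_2 & \mathcal{W}_3 & \mathcal{W}_4\\ \hline \text{type zero} & \chi_1 & \chi_{\bar1\bar245} & \chi_{1235} & \chi_{\bar145}\\ \text{type one} & \chi_{1\bar1} & \chi_{\bar1\bar245} & \chi_{1\bar1235} & \chi_{\bar145}\\ \text{type two} & \chi_{1\bar2} & \chi_{\bar1\bar245} & \chi_{12\bar235} & \chi_{\bar1\bar245}\\ \text{type three} & \chi_{13} & \chi_{\bar1\bar2345} & \chi_{1235} & \chi_{\bar1345} \end{array}$$ That is, the intrinsic tensors $(S,\eta)$ of $M^6$ lie at every point in the listed sum of modules.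
   Context: Conventions. Clifford algebras satisfy $X^2=-|X|^2$. $\bar\Sigma$ is the real rank-8 spinor bundle of the oriented Riemannian spin manifold $\bar M^7$ (with $e_1\cdots e_7=-\mathrm{Id}$ for positively oriented orthonormal frames), with inner product $(\cdot,\cdot)$ for which vectors act skew-symmetrically; Clifford multiplication of $\bar M^7$ is juxtaposition and $\bar\nabla$ is the Levi-Civita connection and its spinor lift. A $\mathrm{G}_2$-manifold is such $\bar M^7$ with a unit spinor field $\phi$; its 3-form is $\Psi(X,Y,Z)=(XYZ\phi,\phi)$, its cross product is defined by $\bar g(X\times Y,Z)=\Psi(X,Y,Z)$, and its intrinsic endomorphism $\bar S$ is the unique endomorphism field with $\bar\nabla_X\phi=\bar S(X)\phi$. $\mathrm{G}_2$ classes: pointwise $\mathrm{End}(T\bar M)=\mathcal{W}_1\oplus\mathcal{W}_2\oplus\mathcal{W}_3\oplus\mathcal{W}_4$, with $\mathcal{W}_1=\mathbb{R}\,\mathrm{Id}$; $\mathcal{W}_2=\mathfrak{g}_2$ (derivations of $\times$); $\mathcal{W}_3$ = symmetric traceless; $\mathcal{W}_4=\{X\mapsto Z\times X\}$. The manifold is of class $\mathcal{W}_\alpha$ if $\bar S$ lies in $\mathcal{W}_\alpha$ at every point. Hypersurface. $M^6$ has unit normal $V$ and is oriented so that (oriented frame of $M^6$, $V$) is oriented in $\bar M^7$. Its spinor bundle is $\Sigma=\bar\Sigma|_{M^6}$ with Clifford multiplication $X\cdot\phi:=VX\phi$; $\nabla$ is its Levi-Civita connection and spinor lift. The Weingarten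 map $W$ is the symmetric endomorphism of $TM^6$ with $\bar\nabla_XY=\nabla_XY+g(W(X),Y)V$; on spinors $\bar\nabla_X\phi=\nabla_X\phi-\frac12VW(X)\phi$. With $j:=e_1\cdots e_6$ ($j^2=-1$, anticommuting with vectors of $M^6$), the unit spinor $\phi|_{M^6}$ defines an $\mathrm{SU}(3)$-structure with almost complex structure $J$, $(JX)\cdot\phi=j(X\cdot\phi)$, and intrinsic tensors $(S,\eta)$ uniquely given by $\nabla_X\phi=\eta(X)j(\phi)+S(X)\cdot\phi$. $\mathrm{SU}(3)$ classes of $(S,\eta)$: $\chi_1$: $S\in\mathbb{R}J$, $\eta=0$; $\chi_{\bar1}$: $S\in\mathbb{R}\,\mathrm{Id}$, $\eta=0$; $\chi_2$: $S$ skew, $SJ=JS$, $\mathrm{tr}(JS)=0$, $\eta=0$; $\chi_{\bar2}$: $S$ symmetric traceless, $SJ=JS$, $\eta=0$; $\chi_3$: $S$ symmetric traceless, $SJ=-JS$, $\eta=0$; $\chi_4$: $S$ skew, $SJ=-JS$, $\eta=0$; $\chi_5$: $S=0$, $\eta$ arbitrary. Multiple indices denote direct sums, e.g. $\chi_{\bar145}=\chi_{\bar1}\oplus\chi_4\oplus\chi_5$. Weingarten types: type zero: $W=0$; type one: $W$ is pointwise a multiple of $\mathrm{Id}$; type two: $W$ is symmetric traceless and commutes with $J$; type three: $W$ is symmetric traceless and anticommutes with $J$. *)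

(* Defs.v *)
From HB Require Import structures.
From mathcomp Require Import all_boot all_order all_algebra.
From mathcomp Require Import all_classical all_reals all_analysis.

Set Implicit Arguments.
Unset Strict Implicit.
Unset Printing Implicit Defensive.

Import Order.TTheory GRing.Theory Num.Theory.
Import numFieldNormedType.Exports.
Local Open Scope classical_set_scope.
Local Open Scope ring_scope.

Section Calculus.
Variables (R : realType) (n : nat).

(* C^oo on a neighbourhood of [a]: all iterated partial derivatives exist and
   are (Frechet) differentiable there. *)
Definition smooth_near (W : normedModType R) (F : 'cV[R]_n -> W) (a : 'cV[R]_n) :=
  \forall x \near a, forall s : seq 'I_n,
    differentiable
      (foldr (fun i (G : 'cV[R]_n -> W) => 'D_(delta_mx i 0) G) F s) x.

(* Jacobian matrix, acting on column vectors from the left (the library's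
   [jacobian] is the transposed convention for row vectors). *)
Definition jac m (F : 'cV[R]_n -> 'cV[R]_m) (a : 'cV[R]_n) : 'M[R]_(m, n) :=
  \matrix_(i, j) ('D_(delta_mx j 0) F a) i 0.

End Calculus.

(* The atlas is indexed by the points: [chart x] is a chart around [x], with
   domain [cdom x] and inverse [cinv x].  Charts are total functions that are
   only meaningful on their domains. *)
Record manifold (R : realType) (n : nat) := Manifold {
  pt :> topologicalType;
  cdom : pt -> set pt;
  chart : pt -> pt -> 'cV[R]_n;
  cinv : pt -> 'cV[R]_n -> pt;
  manifold_hausdorff : hausdorff_space pt;
  manifold_countable : @second_countable pt;
  cdom_open : forall x, open (cdom x);
  cdom_self : forall x, cdom x x;
  chartK : forall x p, cdom x p -> cinv x (chart x p) = p;
  chart_continuous : forall x p, cdom x p -> {for p, continuous (chart x)};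
  chart_open : forall x (A : set pt),
    open A -> A `<=` cdom x -> open (chart x @` A);
  chart_smooth : forall x y p, cdom x p -> cdom y p ->
    smooth_near (chart y \o cinv x) (chart x p) }.

Arguments cdom {R n m} _ _ : rename.
Arguments chart {R n m} _ _ : rename.
Arguments cinv {R n m} _ _ : rename.

Section SmoothMaps.
Variables (R : realType) (n : nat) (N : manifold R n).

Definition smooth_at (W : normedModType R) (F : N -> W) (p : N) :=
  smooth_near (F \o cinv p) (chart p p).

(* The tangent space at [p] is R^n, a vector being identified with its
   coordinates in the chart [chart p]. *)
Definition dir (p : N) (v : 'cV[R]_n) (F : N -> R^o) : R :=
  'D_v (F \o cinv p) (chart p p).

Variables (m : nat) (M : manifold R m).

Definition smooth_map (f : N -> M) := forall p : N,
  {for p, continuous f} /\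
  smooth_near (chart (f p) \o f \o cinv p) (chart p p).

Definition dmap (f : N -> M) (p : N) : 'M[R]_(m, n) :=
  jac (chart (f p) \o f \o cinv p) (chart p p).

End SmoothMaps.

(* Data of a rank-r real vector bundle: every fibre is R^r, and the columns of
   [vframe x q] are the values at [q] of a local frame defined on [vdom x].
   No relation is assumed between the identifications of distinct fibres with
   R^r; the smooth structure is carried by the frames only. *)
Record vbundle (R : realType) n (M : manifold R n) (r : nat) := VBundle {
  vdom : M -> set M;
  vframe : M -> M -> 'M[R]_r }.

Definition is_vbundle (R : realType) n (M : manifold R n) r
    (E : vbundle M r) :=
  [/\ forall x, open (vdom E x) /\ vdom E x x,
      forall x q, vdom E x q -> vframe E x q \in unitmx &
      forall x y p, vdom E x p -> vdom E y p ->
        smooth_at (fun q => invmx (vframe E y q) *m vframe E x q) p].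

(* The columns of the frame are the coordinate vector fields of [chart x]. *)
Definition tangent (R : realType) n (M : manifold R n) : vbundle M n :=
  VBundle (@cdom R n M)
    (fun x q => jac (chart q \o cinv x) (chart x q)).

(* Fibre metrics are given by Gram matrices. *)
Definition ip (R : realType) r (G : 'M[R]_r) (u v : 'cV[R]_r) : R :=
  (u^T *m G *m v) 0 0.

(* Sections of a bundle [E] over M along a map f : N -> M, i.e. sections of the
   pull-back f^*E; ordinary sections are the case f = id. *)
Section Along.
Variables (R : realType) (n m r : nat).
Variables (N : manifold R n) (M : manifold R m) (f : N -> M).
Variable E : vbundle M r.

Definition smooth_sec (s : N -> 'cV[R]_r) (p : N) :=
  smooth_at (fun q => invmx (vframe E (f p) (f q)) *m s q) p.

Definition is_metric (h : N -> 'M[R]_r) :=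
  [/\ forall p, (h p)^T = h p,
      forall p u, u != 0 -> 0 < ip (h p) u u &
      forall p s t, smooth_sec s p -> smooth_sec t p ->
        smooth_at (fun q => ip (h q) (s q) (t q) : R^o) p].

End Along.

Notation smooth_field := (smooth_sec idfun (tangent _)).

Section Connections.
Variables (R : realType) (n m r : nat).
Variables (N : manifold R n) (M : manifold R m) (f : N -> M).
Variable E : vbundle M r.

(* [D p v s] is the covariant derivative at [p] in direction [v] of a section
   along f which is smooth near [p].  Functions and sections only have to be
   smooth near [p], so that locality is part of the Leibniz rule. *)
Definition connection := forall p : N, 'cV[R]_n -> (N -> 'cV[R]_r) -> 'cV[R]_r.

Definition is_connection (D : connection) :=
  [/\ forall p s, smooth_sec f E s p -> linear (fun v => D p v s),
      forall p v s t, smooth_sec f E s p -> smooth_sec f E t p ->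
        D p v (fun q => s q + t q) = D p v s + D p v t,
      forall p v (a : N -> R^o) s, smooth_at a p -> smooth_sec f E s p ->
        D p v (fun q => (a q : R) *: s q)
          = dir p v a *: s p + (a p : R) *: D p v s &
      forall p X s, smooth_field X p -> smooth_sec f E s p ->
        smooth_sec f E (fun q => D q (X q) s) p].

Definition metric_connection (h : N -> 'M[R]_r) (D : connection) :=
  is_connection D /\
  forall p v s t, smooth_sec f E s p -> smooth_sec f E t p ->
    dir p v (fun q => ip (h q) (s q) (t q))
      = ip (h p) (D p v s) (t p) + ip (h p) (s p) (D p v t).

End Connections.

Arguments connection {R n} r N.

(* The vanishing of the torsion is D_X Y - D_Y X = [X, Y], where the bracket is
   evaluated on functions. *)
Definition levi_civita (R : realType) n (N : manifold R n) (g : N -> 'M[R]_n)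
    (D : connection n N) :=
  metric_connection idfun (tangent N) g D /\
  forall (p : N) X Y (a : N -> R^o),
    smooth_field X p -> smooth_field Y p -> smooth_at a p ->
    dir p (D p (X p) Y - D p (Y p) X) a
      = dir p (X p) (fun q => dir q (Y q) a)
        - dir p (Y p) (fun q => dir q (X q) a).

Definition is_pullback (R : realType) n m r (N : manifold R n)
    (M : manifold R m) (f : N -> M) (E : vbundle M r)
    (D : connection r M) (Df : connection r N) :=
  is_connection f E Df /\
  forall p v s, smooth_sec idfun E s (f p) ->
    Df p v (s \o f) = D (f p) (dmap f p *m v) s.

Section Spinors.
Variables (R : realType) (n m : nat).
Variables (N : manifold R n) (M : manifold R m) (f : N -> M).
Variable E : vbundle M 8.
Variables (g : N -> 'M[R]_n) (h : N -> 'M[R]_8).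
Variable c : forall p : N, 'cV[R]_n -> 'M[R]_8.

(* f^*E is a bundle of real rank-8 Clifford modules over (N, g).  For n = 6, and
   for n = 7 with the normalization e_1 ... e_7 = -1, such modules are
   irreducible with commutant R, so the isometries of a fibre covering oriented
   isometries of the tangent space form exactly Spin(n): such a bundle amounts
   to a spin structure together with its real spinor bundle. *)
Definition spinor_bundle :=
  is_metric f E h /\
  [/\ forall p, linear (c p),
      forall p X, c p X *m c p X = (- ip (g p) X X)%:M,
      forall p X a b, ip (h p) (c p X *m a) b = - ip (h p) a (c p X *m b) &
      forall p X s, smooth_field X p -> smooth_sec f E s p ->
        smooth_sec f E (fun q => c q (X q) *m s q) p].

(* The spinor lift of the Levi-Civita connection D, i.e. the metric connection
   for which Clifford multiplication is parallel.  It is unique because real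
   rank-8 Clifford modules in dimensions 6 and 7 are irreducible of real type. *)
Definition spinor_lift (D : connection n N) (DS : connection 8 N) :=
  metric_connection f E h DS /\
  forall p v X s, smooth_field X p -> smooth_sec f E s p ->
    DS p v (fun q => c q (X q) *m s q)
      = c p (D p v X) *m s p + c p (X p) *m DS p v s.

Definition unit_spinor (s : N -> 'cV[R]_8) :=
  forall p, smooth_sec f E s p /\ ip (h p) (s p) (s p) = 1.

End Spinors.

Section Frames.
Variables (R : realType) (n : nat).

Definition orthonormal (G B : 'M[R]_n) := B^T *m G *m B = 1%:M.

Definition frame_prod (c : 'cV[R]_n -> 'M[R]_8) (B : 'M[R]_n) : 'M[R]_8 :=
  \prod_(i < n) c (col i B).

Variable M : manifold R n.

(* An orientation is a nowhere zero o : M -> R, a basis of the tangent space at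
   p (the columns of B) being positive iff 0 < o p * \det B; the sign of the
   coordinate frames has to be locally constant. *)
Definition positive (o : M -> R) (p : M) (B : 'M[R]_n) := 0 < o p * \det B.

Definition is_orientation (o : M -> R) :=
  (forall p, o p != 0) /\
  forall p, \forall q \near p,
    0 < (o p * \det (vframe (tangent M) p p))
        * (o q * \det (vframe (tangent M) p q)).

End Frames.

Record G2_manifold (R : realType) := G2Manifold {
  g2_man :> manifold R 7;
  g2_g : g2_man -> 'M[R]_7;
  g2_or : g2_man -> R;
  g2_E : vbundle g2_man 8;
  g2_h : g2_man -> 'M[R]_8;
  g2_cl : g2_man -> 'cV[R]_7 -> 'M[R]_8;
  g2_phi : g2_man -> 'cV[R]_8;
  g2_gP : is_metric idfun (tangent g2_man) g2_g;
  g2_orP : is_orientation g2_or;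
  g2_EP : is_vbundle g2_E;
  g2_spinP : spinor_bundle idfun g2_E g2_g g2_h g2_cl;
  g2_vol : forall p B, orthonormal (g2_g p) B -> positive g2_or p B ->
    frame_prod (g2_cl p) B = - 1;
  g2_phiP : unit_spinor idfun g2_E g2_h g2_phi }.

Section G2.
Variables (R : realType) (B : G2_manifold R).

Definition g2_Psi (p : B) (X Y Z : 'cV[R]_7) : R :=
  ip (g2_h p) (g2_cl p X *m (g2_cl p Y *m (g2_cl p Z *m g2_phi p))) (g2_phi p).

(* The solution of g (X x Y, Z) = Psi (X, Y, Z). *)
Definition g2_cross (p : B) (X Y : 'cV[R]_7) : 'cV[R]_7 :=
  invmx (g2_g p) *m \col_k g2_Psi p X Y (delta_mx k 0).

Definition g2_intrinsic (DS : connection 8 B) (Sb : B -> 'M[R]_7) :=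
  forall p X, DS p X (@g2_phi R B) = g2_cl p (Sb p *m X) *m g2_phi p.

End G2.

Section Modules.
Variables (R : realType) (n : nat) (G : 'M[R]_n).

Definition symmetric_endo (A : 'M[R]_n) :=
  forall X Y, ip G (A *m X) Y = ip G X (A *m Y).

Definition skew_endo (A : 'M[R]_n) :=
  forall X Y, ip G (A *m X) Y = - ip G X (A *m Y).

End Modules.

Inductive g2_class := W1 | W2 | W3 | W4.

Definition in_g2_class (R : realType) (B : G2_manifold R) (a : g2_class)
    (p : B) (A : 'M[R]_7) : Prop :=
  match a with
  | W1 => exists k : R, A = k%:M
  | W2 => forall X Y,
      A *m g2_cross p X Y = g2_cross p (A *m X) Y + g2_cross p X (A *m Y)
  | W3 => symmetric_endo (g2_g p) A /\ \tr A = 0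
  | W4 => exists Z, forall X, A *m X = g2_cross p Z X
  end.

Record hypersurface (R : realType) (B : G2_manifold R) := Hypersurface {
  hs_man :> manifold R 6;
  hs_f : hs_man -> B;
  hs_V : hs_man -> 'cV[R]_7;
  hs_smooth : smooth_map hs_f;
  hs_immersion : forall p, \rank (dmap hs_f p) = 6;
  hs_V_smooth : forall p, smooth_sec hs_f (tangent B) hs_V p;
  hs_V_unit : forall p, ip (g2_g (hs_f p)) (hs_V p) (hs_V p) = 1;
  hs_V_normal : forall p X,
    ip (g2_g (hs_f p)) (dmap hs_f p *m X) (hs_V p) = 0 }.

Section Hypersurface.
Variables (R : realType) (B : G2_manifold R) (M : hypersurface B).

Definition hs_d (p : M) : 'M[R]_(7, 6) := dmap (@hs_f R B M) p.

Definition hs_g (p : M) : 'M[R]_6 :=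
  (hs_d p)^T *m g2_g (hs_f p) *m hs_d p.

Definition hs_h (p : M) : 'M[R]_8 := g2_h (hs_f p).

(* X . psi = V X psi *)
Definition hs_cl (p : M) (X : 'cV[R]_6) : 'M[R]_8 :=
  g2_cl (hs_f p) (hs_V p) *m g2_cl (hs_f p) (hs_d p *m X).

Definition hs_phi (p : M) : 'cV[R]_8 := g2_phi (hs_f p).

Definition hs_positive (p : M) (F : 'M[R]_6) :=
  positive (@g2_or R B) (hs_f p) (row_mx (hs_d p *m F) (hs_V p) : 'M[R]_(6 + 1)).

(* Gauss formula; DT is the Levi-Civita connection of the ambient manifold on
   vector fields along the hypersurface. *)
Definition weingarten (DT : connection 7 M) (D : connection 6 M)
    (W : M -> 'M[R]_6) :=
  (forall p, symmetric_endo (hs_g p) (W p)) /\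
  forall (p : M) X (Y : M -> 'cV[R]_6), smooth_field Y p ->
    DT p X (fun q => hs_d q *m Y q)
      = hs_d p *m D p X Y + ip (hs_g p) (W p *m X) (Y p) *: hs_V p.

(* j = e_1 ... e_6 for any positive orthonormal frame; the product is the same
   for the Clifford multiplications of M and of the ambient manifold. *)
Definition is_j (p : M) (j : 'M[R]_8) :=
  forall F, orthonormal (hs_g p) F -> hs_positive p F ->
    frame_prod (fun X => g2_cl (hs_f p) (hs_d p *m X)) F = j.

Definition su3_J (J : M -> 'M[R]_6) :=
  forall p j X, is_j p j ->
    hs_cl p (J p *m X) *m hs_phi p = j *m (hs_cl p X *m hs_phi p).

Definition su3_intrinsic (DS : connection 8 M) (S : M -> 'M[R]_6)
    (eta : M -> 'rV[R]_6) :=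
  forall p j X, is_j p j ->
    DS p X hs_phi
      = (eta p *m X) 0 0 *: (j *m hs_phi p) + hs_cl p (S p *m X) *m hs_phi p.

Definition almost_hermitian (J : M -> 'M[R]_6) :=
  forall p, J p *m J p = (- 1)%:M /\
    forall X Y, ip (hs_g p) (J p *m X) (J p *m Y) = ip (hs_g p) X Y.

End Hypersurface.

Inductive su3_class := chi1 | chi1b | chi2 | chi2b | chi3 | chi4 | chi5.

Section SU3Classes.
Variables (R : realType) (G J : 'M[R]_6).

Definition in_su3_class (c : su3_class) (S : 'M[R]_6) (eta : 'rV[R]_6) : Prop :=
  match c with
  | chi1 => (exists k : R, S = k *: J) /\ eta = 0
  | chi1b => (exists k : R, S = k%:M) /\ eta = 0
  | chi2 => [/\ skew_endo G S, S *m J = J *m S, \tr (J *m S) = 0 & eta = 0]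
  | chi2b => [/\ symmetric_endo G S, \tr S = 0, S *m J = J *m S & eta = 0]
  | chi3 => [/\ symmetric_endo G S, \tr S = 0, S *m J = - (J *m S) & eta = 0]
  | chi4 => [/\ skew_endo G S, S *m J = - (J *m S) & eta = 0]
  | chi5 => S = 0
  end.

Fixpoint in_su3_sum (l : seq su3_class) (S : 'M[R]_6) (eta : 'rV[R]_6) : Prop :=
  match l with
  | [::] => S = 0 /\ eta = 0
  | c :: l' => exists S1 eta1 S2 eta2,
      [/\ S = S1 + S2, eta = eta1 + eta2,
          in_su3_class c S1 eta1 & in_su3_sum l' S2 eta2]
  end.

End SU3Classes.

Inductive weingarten_type := type0 | type1 | type2 | type3.

Definition in_weingarten_type (R : realType) (G J : 'M[R]_6)
    (t : weingarten_type) (W : 'M[R]_6) : Prop :=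
  match t with
  | type0 => W = 0
  | type1 => exists k : R, W = k%:M
  | type2 => [/\ symmetric_endo G W, \tr W = 0 & W *m J = J *m W]
  | type3 => [/\ symmetric_endo G W, \tr W = 0 & W *m J = - (J *m W)]
  end.

Definition su3_table (t : weingarten_type) (a : g2_class) : seq su3_class :=
  match t, a with
  | type0, W1 => [:: chi1]
  | type0, W2 => [:: chi1b; chi2b; chi4; chi5]
  | type0, W3 => [:: chi1; chi2; chi3; chi5]
  | type0, W4 => [:: chi1b; chi4; chi5]
  | type1, W1 => [:: chi1; chi1b]
  | type1, W2 => [:: chi1b; chi2b; chi4; chi5]
  | type1, W3 => [:: chi1; chi1b; chi2; chi3; chi5]
  | type1, W4 => [:: chi1b; chi4; chi5]
  | type2, W1 => [:: chi1; chi2b]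
  | type2, W2 => [:: chi1b; chi2b; chi4; chi5]
  | type2, W3 => [:: chi1; chi2; chi2b; chi3; chi5]
  | type2, W4 => [:: chi1b; chi2b; chi4; chi5]
  | type3, W1 => [:: chi1; chi3]
  | type3, W2 => [:: chi1b; chi2b; chi3; chi4; chi5]
  | type3, W3 => [:: chi1; chi2; chi3; chi5]
  | type3, W4 => [:: chi1b; chi3; chi4; chi5]
  end.

(* Main.v *)
Require Import Defs.
From HB Require Import structures.
From mathcomp Require Import all_boot all_order all_algebra all_fingroup.
From mathcomp Require Import all_classical all_reals all_analysis.
From mathcomp Require Import ring lra.

(* Along the hypersurface, the difference between the spinor lift [DS] of the
   Levi-Civita connection and the pull-back of the ambient spinor connection
   corrected by [V W / 2] is tensorial, skew, and commutes with the Clifford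
   multiplication of the hypersurface; on [phi] such an endomorphism vanishes.
   Hence the spinorial Gauss formula
     [DS_X phi = Sb X phi + V (W X) phi / 2].
   Moreover [e_1 ... e_7 = -1] gives [j = V], so that [V X phi = (J X) phi] for
   tangent [X].  As [X |-> X phi] is injective, the definition of [(S, eta)]
   becomes
     [S = - J T + W / 2]  and  [eta X = g (Sb X, V)],
   where [T] is the tangential part of [Sb].  It remains to decompose [- J T]:
   [T] is a multiple of the identity, skew, symmetric, or, for [Sb X = Z x X],
   the sum of a multiple of [J] and of a skew map anticommuting with [J]. *)

Set Implicit Arguments.
Unset Strict Implicit.
Unset Printing Implicit Defensive.

Import Order.TTheory GRing.Theory Num.Theory.
Import numFieldNormedType.Exports.
Local Open Scope classical_set_scope.
Local Open Scope ring_scope.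

(** * Smooth functions *)

(** The obstacle is that [DS] is not given by a formula: [spinor_lift] only lists its properties,
    and only for germs of smooth sections. Its value on [phi] has to be forced by a uniqueness
    argument, and this requires differentiating ambient spinors along the hypersurface. A pull-back
    of [DbS] is not among the data, so it is built from local frames, at one point and in one
    direction; the ambient product rules are carried over because their defects are tensorial. All
    the rest is linear algebra at one point. In the final decomposition, barred and unbarred modules
    are told apart by one sign: multiplication by [J] exchanges symmetric and skew maps among those
    commuting with [J], and preserves both kinds among those anticommuting with it. So a skew [T]
    yields [chi1b], [chi2b], [chi4], a symmetric [T] yields [chi1], [chi2], [chi3], and [W / 2] adds
    the symmetric module of its row. For [W2], defined by derivations, skewness has to be derived;
    it comes from the double cross product. *)

Section Differentiability.
Variables (R : realType) (V : normedModType R).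

(** [g] is [f] plus a function that vanishes near [x], and such a function satisfies the definition
    of differentiability with differential 0. *)
Lemma near_eq_differentiable (W : normedModType R) (f g : V -> W) (x : V) :
  (\forall y \near x, f y = g y) -> differentiable f x -> differentiable g x.
Proof.
move=> fg df.
pose h y := g y - f y.
have h0 : \forall y \near x, h y = 0.
  by near=> y; rewrite /h (near fg) ?subrr //; near: y.
suff dh : differentiable h x.
  have -> : g = f + h by apply/funext => y; rewrite fctE /h addrC subrK.
  exact: differentiableD.
have hx : h x = 0 := nbhs_singleton h0.
have [cl0 _] := (diff_locallyP _ _).1 (differentiable_cst (0 : W) x).
have hE : h \o shift x = cst (h x) + 'd (cst (0 : W)) x +o_ 0 id.
  apply/eqaddoP => _/posnumP[e].
  have : \forall y \near (0 : V), h (y + x) = 0.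
    by move: h0; rewrite (near_shift 0) subr0.
  apply: filterS => y hy.
  by rewrite !fctE /= hy hx diff_cst !addr0 subr0 normr0 mulr_ge0.
by apply/diff_locallyP; rewrite (diff_unique cl0 hE); split.
Unshelve. all: by end_near. Qed.

Lemma differentiable_mxP m n (M : V -> 'M[R]_(m, n)) x :
  differentiable M x <->
  forall i j, differentiable (fun y => M y i j : R^o) x.
Proof.
split=> [dM i j|dM].
  by apply: (@differentiable_comp _ _ _ _ M
    (fun N : 'M[R]_(m, n) => N i j : R^o)) (dM) _; exact: differentiable_coord.
have -> : M = \sum_(i < m) \sum_(j < n) (fun y => (M y i j : R^o) *: delta_mx i j).
  apply/funext => y; rewrite [LHS]matrix_sum_delta fct_sumE.
  by apply: eq_bigr => i _; rewrite fct_sumE.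
apply: differentiable_sum => i; apply: differentiable_sum => j.
exact: differentiableZl.
Qed.

Lemma derive_mxE m n (M : V -> 'M[R]_(m, n)) x v i j : differentiable M x ->
  ('D_v M x) i j = 'D_v (fun y => M y i j : R^o) x.
Proof.
by move=> dM; rewrite derive_mx ?mxE //; exact: diff_derivable.
Qed.

End Differentiability.

Lemma derive_col (R : realType) n (W : normedModType R) (F : 'cV[R]_n -> W)
    x v : differentiable F x ->
  'D_v F x = \sum_(j < n) v j 0 *: 'D_(delta_mx j 0) F x.
Proof.
move=> dF; rewrite deriveE // [in LHS](matrix_sum_delta v) linear_sum.
apply: eq_bigr => j _; rewrite big_ord1 linearZ /=; congr (_ *: _).
by rewrite deriveE.
Qed.

Lemma derive_comp (R : realType) (U V W : normedModType R) (f : U -> V)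
    (g : V -> W) x v : differentiable f x -> differentiable g (f x) ->
  'D_v (g \o f) x = 'D_('D_v f x) g (f x).
Proof.
move=> df dg; rewrite !deriveE //; last exact: differentiable_comp.
by rewrite diff_comp.
Qed.

Section SmoothOn.
Variables (R : realType) (n : nat).
Implicit Types (U : set 'cV[R]_n) (f g : 'cV[R]_n -> R^o).

Local Notation "'d_ i F" := ('D_(delta_mx i 0) F) (at level 10, i at level 0).

(** Replaces the sequences of directions in [smooth_near] by an order on which products and
    composites allow induction. The order is shifted: [Ck U 0] already asks for Frechet
    differentiability. *)
Fixpoint Ck (W : normedModType R) U k (F : 'cV[R]_n -> W) : Prop :=
  (forall x, U x -> differentiable F x) /\
  if k is k'.+1 then forall i : 'I_n, Ck U k' ('d_i F) else True.

Definition smooth_on (W : normedModType R) U (F : 'cV[R]_n -> W) :=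
  forall k, Ck U k F.

Lemma Ck_diff (W : normedModType R) U k (F : 'cV[R]_n -> W) x :
  Ck U k F -> U x -> differentiable F x.
Proof. by case: k => [|k] [dF _]; exact: dF. Qed.

Lemma CkW (W : normedModType R) U k (F : 'cV[R]_n -> W) :
  Ck U k.+1 F -> Ck U k F.
Proof.
elim: k F => [|k IH] F [dF CF]; split=> // i; apply: IH; exact: CF.
Qed.

Lemma Ck_eq (W : normedModType R) U k (F G : 'cV[R]_n -> W) : open U ->
  (forall x, U x -> F x = G x) -> Ck U k F -> Ck U k G.
Proof.
move=> Uo; have nearE (F' G' : 'cV[R]_n -> W) x : (forall x, U x -> F' x = G' x) ->
    U x -> \forall y \near x, F' y = G' y.
  by move=> FG Ux; apply: filterS (open_nbhs_nbhs (conj Uo Ux)) => y; exact: FG.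
have dE (F' G' : 'cV[R]_n -> W) : (forall x, U x -> F' x = G' x) ->
    (forall x, U x -> differentiable F' x) -> forall x, U x -> differentiable G' x.
  by move=> FG dF x Ux; apply: near_eq_differentiable (dF _ Ux); exact: nearE.
elim: k F G => [|k IH] F G FG [dF CF]; split=> //; try exact: dE FG dF.
move=> i; apply: IH (CF i) => x Ux; apply: near_eq_derive; exact: nearE.
Qed.

Lemma Ck_sub (W : normedModType R) U U' k (F : 'cV[R]_n -> W) :
  U' `<=` U -> Ck U k F -> Ck U' k F.
Proof.
move=> sU; elim: k F => [|k IH] F [dF CF]; split=> //; try by move=> x /sU; exact: dF.
by move=> i; exact: IH (CF i).
Qed.

Lemma smooth_nearP (W : normedModType R) (F : 'cV[R]_n -> W) a :
  smooth_near F a <-> exists U, [/\ open U, U a & smooth_on U F].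
Proof.
have P U : smooth_on U F <-> forall x, U x -> forall s : seq 'I_n,
    differentiable (foldr (fun i (G : 'cV[R]_n -> W) => 'd_i G) F s) x.
  split=> [CF x Ux s|H k].
    (* In the [foldr] the last direction of [s] acts on [F] first, hence the induction from the end
       of the list. *)
    elim/last_ind: s F CF => [|s i IH] F CF; first exact: (Ck_diff (CF 0%N)).
    rewrite foldr_rcons; apply: IH => k.
    by have [_] := CF k.+1; apply.
  elim: k F H => [|k IH] F H; split=> //; try by move=> x Ux; exact: (H x Ux [::]).
  by move=> i; apply: IH => x Ux s; rewrite -foldr_rcons; exact: H.
split.
  rewrite /smooth_near /prop_near1 nbhsE => -[U [Uo Ua] UF]; exists U; split=> //.
  by apply/P => x Ux; exact: UF.
move=> [U [Uo Ua /P UF]].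
by apply: filterS (open_nbhs_nbhs (conj Uo Ua)).
Qed.


Lemma smooth_onP (W : normedModType R) U (F : 'cV[R]_n -> W) : smooth_on U F <->
  (forall x, U x -> differentiable F x) /\ forall i, smooth_on U ('d_i F).
Proof.
split=> [CF|[dF CF] [|k]]; last 2 first.
- by split.
- by split=> // i; exact: CF.
split=> [|i k]; first by case: (CF 0%N).
by have [_] := CF k.+1; exact.
Qed.

Lemma Ck_cst (W : normedModType R) U k (w : W) :
  Ck U k (fun _ : 'cV[R]_n => w).
Proof.
elim: k w => [|k IH] w;
  (split; first by move=> x _; exact: differentiable_cst) => // i.
have -> : 'd_i (fun _ : 'cV[R]_n => w) = fun _ => 0.
  by apply/funext => x; rewrite derive_cst.
exact: IH.
Qed.

Lemma CkD (W : normedModType R) U k (F G : 'cV[R]_n -> W) : open U ->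
  Ck U k F -> Ck U k G -> Ck U k (fun x => F x + G x).
Proof.
move=> Uo; elim: k F G => [|k IH] F G [dF CF] [dG CG];
  (split; first by move=> x Ux; apply: differentiableD; [exact: dF|exact: dG]) => //.
move=> i; apply: Ck_eq (IH _ _ (CF i) (CG i)) => // x Ux.
rewrite deriveD //; apply: diff_derivable; [exact: dF|exact: dG].
Qed.

Lemma Ck_sum (W : normedModType R) U k (I : Type) (r : seq I)
    (F : I -> 'cV[R]_n -> W) : open U ->
  (forall i, Ck U k (F i)) -> Ck U k (fun x => \sum_(i <- r) F i x).
Proof.
move=> Uo CF; elim: r => [|i r IH].
  by apply: Ck_eq (Ck_cst _ _ 0) => // x _; rewrite big_nil.
by apply: Ck_eq (CkD Uo (CF i) IH) => // x _; rewrite big_cons.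
Qed.

Lemma CkM U k f g : open U ->
  Ck U k f -> Ck U k g -> Ck U k (fun x => f x * g x : R^o).
Proof.
move=> Uo; elim: k f g => [|k IH] f g;
  move=> Cf Cg; have [df Df] := Cf; have [dg Dg] := Cg;
  (split; first by move=> x Ux; apply: differentiableM; [exact: df|exact: dg]) => //.
move=> i; have Cf' := CkW Cf; have Cg' := CkW Cg.
apply: Ck_eq (CkD Uo (IH _ _ Cf' (Dg i)) (IH _ _ Cg' (Df i))) => // x Ux.
rewrite [RHS]deriveM //; apply: diff_derivable; [exact: df|exact: dg].
Qed.

End SmoothOn.

Lemma Ck_mxP (R : realType) n m1 m2 (U : set 'cV[R]_n) k
    (F : 'cV[R]_n -> 'M[R]_(m1, m2)) : open U ->
  Ck U k F <-> forall i j, Ck U k (fun x => F x i j : R^o).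
Proof.
move=> Uo; elim: k F => [|k IH] F; split=> [[dF CF] i j|CF].
- by split=> // x Ux; have /differentiable_mxP := dF x Ux; apply.
- by split=> // x Ux; apply/differentiable_mxP => i j; exact: Ck_diff (CF i j) Ux.
- split=> [x Ux|l]; first by have /differentiable_mxP := dF x Ux; apply.
  have /IH/(_ i j) := CF l; apply: Ck_eq => // x Ux.
  by rewrite derive_mxE //; exact: dF.
- have dF x : U x -> differentiable F x.
    by move=> Ux; apply/differentiable_mxP => i j; exact: Ck_diff (CF i j) Ux.
  split=> // l; apply/IH => i j; have [_ /(_ l)] := CF i j.
  by apply: Ck_eq => // x Ux; rewrite derive_mxE //; exact: dF.
Qed.

(** By the chain rule a partial derivative of [f \o G] is a sum of products of a partial derivative
    of [f] composed with [G] and a derivative of [G]. The first factor falls under the induction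
    hypothesis once [G] is weakened by one order. *)
Lemma Ck_comp (R : realType) n m (W : normedModType R) (U : set 'cV[R]_n)
    (U' : set 'cV[R]_m) k (G : 'cV[R]_n -> 'cV[R]_m) (f : 'cV[R]_m -> R^o) :
  open U -> (forall x, U x -> U' (G x)) ->
  Ck U' k f -> Ck U k G -> Ck U k (f \o G).
Proof.
move=> Uo UU'; elim: k f => [|k IH] f Cf CG; have [df Df] := Cf;
  have [dG DG] := CG;
  have dfG x : U x -> differentiable (f \o G) x by
    move=> Ux; apply: differentiable_comp; [exact: dG|exact/df/UU'].
  by split.
split=> // i.
have CD (j : 'I_m) : Ck U k (fun x => ('D_(delta_mx j 0) f \o G) x
    * ('D_(delta_mx i 0) G x) j 0 : R^o).
  apply: CkM => //; first by apply: IH; [exact: Df|exact: CkW CG].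
  by have /Ck_mxP := DG i; exact.
apply: Ck_eq (Ck_sum (index_enum 'I_m) Uo CD) => // x Ux.
have dGx := dG x Ux; have dfx := df _ (UU' _ Ux).
rewrite [RHS](derive_comp _ dGx dfx) [RHS]derive_col //.
by apply: eq_bigr => j _; rewrite /= mulrC.
Qed.

Section SmoothNear.
Variables (R : realType) (n : nat).
Implicit Types (a : 'cV[R]_n) (f g : 'cV[R]_n -> R^o).

Lemma smooth_near_lift (W1 W2 : normedModType R) (F : 'cV[R]_n -> W1)
    (G : 'cV[R]_n -> W2) a :
  (forall U, open U -> U a -> smooth_on U F -> smooth_on U G) ->
  smooth_near F a -> smooth_near G a.
Proof.
move=> H /smooth_nearP[U [Uo Ua CF]].
by apply/smooth_nearP; exists U; split=> //; exact: H.
Qed.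

Lemma smooth_near_diff (W : normedModType R) (F : 'cV[R]_n -> W) a :
  smooth_near F a -> differentiable F a.
Proof. by move=> /smooth_nearP[U [Uo Ua /(_ 0%N)]] [+ _]; apply. Qed.

Lemma smooth_near_near (W : normedModType R) (F : 'cV[R]_n -> W) a :
  smooth_near F a -> \forall x \near a, differentiable F x.
Proof.
move=> /smooth_nearP[U [Uo Ua /(_ 0%N)]] [dF _].
by apply: filterS (open_nbhs_nbhs (conj Uo Ua)).
Qed.

Lemma smooth_near_partial (W : normedModType R) (F : 'cV[R]_n -> W) a i :
  smooth_near F a -> smooth_near ('D_(delta_mx i 0) F) a.
Proof. by apply: smooth_near_lift => U _ _ /smooth_onP[]. Qed.

Lemma smooth_near_eq (W : normedModType R) (F G : 'cV[R]_n -> W) a :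
  (\forall x \near a, F x = G x) -> smooth_near F a -> smooth_near G a.
Proof.
rewrite /prop_near1 nbhsE => -[U [Uo Ua] FG] /smooth_nearP[U' [U'o U'a CF]].
apply/smooth_nearP; exists (U `&` U'); split=> // [|k]; first exact: openI.
apply: (@Ck_eq _ _ _ _ _ F); [exact: openI|by move=> x [/FG]|].
by apply: Ck_sub (CF k) => x [].
Qed.

Lemma smooth_near_ext (W : normedModType R) (F G : 'cV[R]_n -> W) a :
  (forall x, F x = G x) -> smooth_near F a -> smooth_near G a.
Proof. by move=> /funext ->. Qed.

Lemma smooth_near_cst (W : normedModType R) (w : W) a :
  smooth_near (fun _ : 'cV[R]_n => w) a.
Proof.
apply/smooth_nearP; exists setT; split=> // [|k]; first exact: openT.
exact: Ck_cst.
Qed.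

Lemma smooth_nearM f g a : smooth_near f a -> smooth_near g a ->
  smooth_near (fun x => f x * g x : R^o) a.
Proof.
move=> /smooth_nearP[U [Uo Ua Cf]] /smooth_nearP[U' [U'o U'a Cg]].
have UUo := openI Uo U'o.
apply/smooth_nearP; exists (U `&` U'); split=> // k.
by apply: CkM => //; [apply: Ck_sub (Cf k)|apply: Ck_sub (Cg k)] => x [].
Qed.

Lemma smooth_nearD (W : normedModType R) (F G : 'cV[R]_n -> W) a :
  smooth_near F a -> smooth_near G a -> smooth_near (fun x => F x + G x) a.
Proof.
move=> /smooth_nearP[U [Uo Ua CF]] /smooth_nearP[U' [U'o U'a CG]].
have UUo := openI Uo U'o.
apply/smooth_nearP; exists (U `&` U'); split=> // k.
by apply: CkD => //; [apply: Ck_sub (CF k)|apply: Ck_sub (CG k)] => x [].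
Qed.

Lemma smooth_near_sum (W : normedModType R) (I : Type) (r : seq I)
    (F : I -> 'cV[R]_n -> W) a : (forall i, smooth_near (F i) a) ->
  smooth_near (fun x => \sum_(i <- r) F i x) a.
Proof.
move=> sF; elim: r => [|i r IH].
  by apply: smooth_near_ext (smooth_near_cst 0 _) => x; rewrite big_nil.
by apply: smooth_near_ext (smooth_nearD (sF i) IH) => x; rewrite big_cons.
Qed.

Lemma smooth_near_mxP m1 m2 (F : 'cV[R]_n -> 'M[R]_(m1, m2)) a :
  smooth_near F a <-> forall i j, smooth_near (fun x => F x i j : R^o) a.
Proof.
split=> [+ i j|sF].
  by apply: smooth_near_lift => U Uo _ CF k; have /Ck_mxP := CF k; exact.
have -> : F = fun x => \sum_i \sum_j F x i j *: delta_mx i j.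
  by apply/funext => x; exact: matrix_sum_delta.
apply: smooth_near_sum => i; apply: smooth_near_sum => j.
have := sF i j; apply: smooth_near_lift => U Uo _ CF k.
apply/Ck_mxP => // i' j'.
apply: Ck_eq (CkM Uo (CF k) (Ck_cst _ _ (delta_mx i j i' j' : R^o))) => // x _.
by rewrite !mxE.
Qed.

Lemma smooth_near_mulmx m1 m2 m3 (F : 'cV[R]_n -> 'M[R]_(m1, m2))
    (G : 'cV[R]_n -> 'M[R]_(m2, m3)) a :
  smooth_near F a -> smooth_near G a -> smooth_near (fun x => F x *m G x) a.
Proof.
move=> /smooth_near_mxP sF /smooth_near_mxP sG; apply/smooth_near_mxP => i j.
have H := smooth_near_sum (index_enum 'I_m2) (fun k => smooth_nearM (sF i k) (sG k j)).
by apply: smooth_near_ext H => x; rewrite mxE.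
Qed.

End SmoothNear.

Lemma smooth_near_comp (R : realType) n m (F : 'cV[R]_m -> R^o)
    (G : 'cV[R]_n -> 'cV[R]_m) a :
  smooth_near F (G a) -> smooth_near G a -> smooth_near (F \o G) a.
Proof.
move=> sF sG; have cG := differentiable_continuous (smooth_near_diff sG).
move: sG sF => /smooth_nearP[U [Uo Ua CG]] /smooth_nearP[U' [U'o U'a Cf]].
have aU : nbhs a U by exact: open_nbhs_nbhs.
have aU' : nbhs a (G @^-1` U') by apply: (cG U'); exact: open_nbhs_nbhs.
have : nbhs a (U `&` G @^-1` U') by exact: filterI.
rewrite nbhsE => -[A [Ao Aa] sA].
apply/smooth_nearP; exists A; split=> // k.
apply: (@Ck_comp _ _ _ R^o A U' k G F) => //.
  by move=> x /sA[].
by apply: Ck_sub (CG k) => x /sA[].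
Qed.

Section Jacobian.
Variable R : realType.

Lemma smooth_near_jac n m (F : 'cV[R]_n -> 'cV[R]_m) a :
  smooth_near F a -> smooth_near (jac F) a.
Proof.
move=> sF; apply/smooth_near_mxP => i j.
have /smooth_near_mxP/(_ i 0) := smooth_near_partial j sF.
by apply: smooth_near_ext => x; rewrite mxE.
Qed.

Lemma jacE n m (F : 'cV[R]_n -> 'cV[R]_m) a v : differentiable F a ->
  jac F a *m v = 'D_v F a.
Proof.
move=> dF; rewrite derive_col //; apply/colP => i; rewrite mxE summxE.
by apply: eq_bigr => j _; rewrite !mxE mulrC.
Qed.

Lemma jac_comp n m l (F : 'cV[R]_n -> 'cV[R]_m) (G : 'cV[R]_m -> 'cV[R]_l) a :
  differentiable F a -> differentiable G (F a) ->
  jac (G \o F) a = jac G (F a) *m jac F a.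
Proof.
move=> dF dG; apply/matrixP => i j; rewrite mxE derive_comp // -jacE // !mxE.
by apply: eq_bigr => k _; rewrite !mxE.
Qed.

Lemma jac_eq n m (F G : 'cV[R]_n -> 'cV[R]_m) a :
  (\forall x \near a, F x = G x) -> jac F a = jac G a.
Proof.
by move=> FG; apply/matrixP => i j; rewrite !mxE; congr (fun_of_matrix _ _ _);
  exact: near_eq_derive.
Qed.

Lemma jac_id n (a : 'cV[R]_n) : jac id a = 1%:M.
Proof.
apply/matrixP => i j; rewrite mxE derive_id !mxE eqxx andbT.
by rewrite eq_sym.
Qed.

End Jacobian.

(** * Smooth maps between manifolds *)

Section Charts.
Variables (R : realType) (n : nat) (N : manifold R n).
Implicit Types (p q x : N).

(** The record gives [cinv] only as a left inverse of [chart]. Openness of the images of open sets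
    makes it a right inverse near [chart x p] and plays the part of its continuity. *)
Lemma near_cinv x p (P : set N) : cdom x p -> (\forall q \near p, P q) ->
  \forall y \near chart x p,
    [/\ P (cinv x y), cdom x (cinv x y) & chart x (cinv x y) = y].
Proof.
move=> xp; rewrite /prop_near1 nbhsE => -[U [Uo Up] UP].
have Ao : open (chart x @` (U `&` cdom x)).
  by apply: chart_open; [apply: openI => //; exact: cdom_open|move=> ? []].
have Ap : (chart x @` (U `&` cdom x)) (chart x p) by exists p.
apply: filterS (open_nbhs_nbhs (conj Ao Ap)) => y [q [Uq xq] <-].
by rewrite chartK //; split=> //; exact: UP.
Qed.

Lemma near_chart x p (Q : set 'cV[R]_n) : cdom x p ->
  (\forall y \near chart x p, Q y) -> \forall q \near p, Q (chart x q).
Proof. by move=> xp HQ; exact: (chart_continuous xp HQ). Qed.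

Lemma near_cdom x p : cdom x p -> \forall q \near p, cdom x q.
Proof. by move=> xp; apply: open_nbhs_nbhs; split=> //; exact: cdom_open. Qed.

Lemma near_chart_self p (P : set N) : (\forall q \near p, P q) ->
  \forall y \near chart p p, P (cinv p y).
Proof. by move=> /(near_cinv (cdom_self p)); apply: filterS => y []. Qed.

Section Functions.
Variable W : normedModType R.
Implicit Types F G : N -> W.

Lemma smooth_at_eq F G p : (\forall q \near p, F q = G q) ->
  smooth_at F p -> smooth_at G p.
Proof. by move=> /near_chart_self; exact: smooth_near_eq. Qed.

Lemma smooth_at_cst (w : W) p : smooth_at (fun _ : N => w) p.
Proof. exact: smooth_near_cst. Qed.

Lemma smooth_at_sum (I : Type) (r : seq I) (F : I -> N -> W) p :
  (forall i, smooth_at (F i) p) -> smooth_at (fun q => \sum_(i <- r) F i q) p.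
Proof. exact: smooth_near_sum. Qed.

End Functions.

Lemma smooth_at_mxP m1 m2 (F : N -> 'M[R]_(m1, m2)) p :
  smooth_at F p <-> forall i j, smooth_at (fun q => F q i j : R^o) p.
Proof. exact: smooth_near_mxP. Qed.

Lemma smooth_atM (a b : N -> R^o) p : smooth_at a p -> smooth_at b p ->
  smooth_at (fun q => a q * b q : R^o) p.
Proof. exact: smooth_nearM. Qed.

Lemma smooth_at_mulmx m1 m2 m3 (F : N -> 'M[R]_(m1, m2))
    (G : N -> 'M[R]_(m2, m3)) p :
  smooth_at F p -> smooth_at G p -> smooth_at (fun q => F q *m G q) p.
Proof. exact: smooth_near_mulmx. Qed.

Lemma smooth_atZ m1 m2 (a : N -> R^o) (F : N -> 'M[R]_(m1, m2)) p :
  smooth_at a p -> smooth_at F p -> smooth_at (fun q => (a q : R) *: F q) p.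
Proof.
move=> sa /smooth_at_mxP sF; apply/smooth_at_mxP => i j.
by apply: smooth_near_ext (smooth_atM sa (sF i j)) => x; rewrite /= mxE.
Qed.

Section Dir.
Variables (p : N) (v : 'cV[R]_n).
Implicit Types a b : N -> R^o.

Lemma dir_eq a b : (\forall q \near p, a q = b q) -> dir p v a = dir p v b.
Proof. by move=> /near_chart_self ?; exact: near_eq_derive. Qed.

Lemma dir_cst (k : R) : dir p v (fun _ => k) = 0.
Proof. exact: derive_cst. Qed.

Lemma dirD a b : smooth_at a p -> smooth_at b p ->
  dir p v (fun q => a q + b q) = dir p v a + dir p v b.
Proof.
by move=> /smooth_near_diff da /smooth_near_diff db; apply: deriveD;
  exact: diff_derivable.
Qed.

Lemma dirM a b : smooth_at a p -> smooth_at b p ->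
  dir p v (fun q => a q * b q) = a p * dir p v b + b p * dir p v a.
Proof.
move=> /smooth_near_diff da /smooth_near_diff db.
rewrite /dir [LHS]deriveM /=; try exact: diff_derivable.
by rewrite chartK //; exact: cdom_self.
Qed.

End Dir.

Lemma smooth_map_id : smooth_map (idfun : N -> N).
Proof.
by move=> p; split; [exact: cvg_id|apply: chart_smooth; exact: cdom_self].
Qed.

(** Chain rule for [chart p \o cinv x \o chart x \o cinv p], which is the identity only near
    [chart p p]. It makes the frames of [tangent] invertible. *)
Lemma jac_chart_inv x p : cdom x p ->
  jac (chart p \o cinv x) (chart x p) *m jac (chart x \o cinv p) (chart p p) = 1%:M.
Proof.
move=> xp; have pp := cdom_self p.
have E : chart x p = (chart x \o cinv p) (chart p p) by rewrite /= chartK.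
have d1 := smooth_near_diff (chart_smooth pp xp).
have d2 := smooth_near_diff (chart_smooth xp pp).
have {}d2 : differentiable (chart p \o cinv x) ((chart x \o cinv p) (chart p p)).
  by rewrite -E.
rewrite {1}E -(jac_comp d1 d2).
rewrite -(jac_id (chart p p)); apply: jac_eq.
have := near_cinv pp (near_cdom xp); apply: filterS => y [xy _ yK].
by rewrite /= (chartK xy) yK.
Qed.

End Charts.

Section Maps.
Variables (R : realType) (n m : nat) (N : manifold R n) (M : manifold R m).
Variables (f : N -> M) (sf : smooth_map f).
Implicit Type p : N.

Lemma near_map p (P : set M) : (\forall q \near f p, P q) ->
  \forall q \near p, P (f q).
Proof. by case: (sf p) => cf _ /cf. Qed.

(** Continuity of [f] keeps [f (cinv p y)] in the domain of [chart (f p)], so the local expression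
    of [f] can be inserted into functions on [M]. *)
Lemma near_local_expr p : \forall y \near chart p p,
  cinv (f p) (chart (f p) (f (cinv p y))) = f (cinv p y).
Proof.
pose P q := cinv (f p) (chart (f p) q) = q.
apply: (near_chart_self (P := fun q => P (f q))); apply: near_map.
have := near_cdom (cdom_self (f p)); apply: filterS => q; exact: chartK.
Qed.

Lemma local_expr_self p : (chart (f p) \o f \o cinv p) (chart p p) = chart (f p) (f p).
Proof. by rewrite /= chartK //; exact: cdom_self. Qed.

Lemma smooth_at_comp (a : M -> R^o) p : smooth_at a (f p) -> smooth_at (a \o f) p.
Proof.
case: (sf p) => _ sfp sa.
have := smooth_near_comp (F := a \o cinv (f p)) (G := chart (f p) \o f \o cinv p)
  (a := chart p p).
rewrite local_expr_self => /(_ sa sfp); apply: smooth_near_eq.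
by have := near_local_expr p; apply: filterS => y /= ->.
Qed.

Lemma smooth_at_comp_mx m1 m2 (F : M -> 'M[R]_(m1, m2)) p :
  smooth_at F (f p) -> smooth_at (F \o f) p.
Proof.
move=> /smooth_at_mxP sF; apply/smooth_at_mxP => i j.
exact: (smooth_at_comp (sF i j)).
Qed.

Lemma dir_comp (a : M -> R^o) p v : smooth_at a (f p) ->
  dir p v (a \o f) = dir (f p) (dmap f p *m v) a.
Proof.
case: (sf p) => _ /smooth_near_diff dfp /smooth_near_diff da.
rewrite /dmap jacE // /dir -(local_expr_self p) -derive_comp //; last first.
  by rewrite local_expr_self.
apply: near_eq_derive.
by have := near_local_expr p; apply: filterS => y /= ->.
Qed.

End Maps.

Lemma mulmx_sum_col (R : comPzRingType) m n (A : 'M[R]_(m, n)) (c : 'cV[R]_n) :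
  A *m c = \sum_i c i 0 *: col i A.
Proof.
apply/colP => k; rewrite mxE summxE; apply: eq_bigr => i _.
by rewrite !mxE mulrC.
Qed.

(** * Sections along a map *)

Definition framed (R : realType) n (M : manifold R n) r (E : vbundle M r) :=
  (forall x, open (vdom E x) /\ vdom E x x) /\
  forall x q, vdom E x q -> vframe E x q \in unitmx.

Lemma vbundle_framed (R : realType) n (M : manifold R n) r (E : vbundle M r) :
  is_vbundle E -> framed E.
Proof. by case. Qed.

Lemma tangent_framed (R : realType) n (M : manifold R n) : framed (tangent M).
Proof.
split=> [x|x q xq]; first by split; [exact: cdom_open|exact: cdom_self].
by have [] := mulmx1_unit (jac_chart_inv xq).
Qed.

Definition local_frame (R : realType) n (M : manifold R n) r (E : vbundle M r)
  x i q : 'cV[R]_r := col i (vframe E x q).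

Section Frames.
Variables (R : realType) (n m r : nat) (N : manifold R n) (M : manifold R m).
Variables (f : N -> M) (sf : smooth_map f).
Variables (E : vbundle M r) (fE : framed E).
Implicit Types (p q : N) (s t : N -> 'cV[R]_r).

Lemma near_vdom p : \forall q \near p, vdom E (f p) (f q).
Proof.
apply: (near_map sf); apply: open_nbhs_nbhs.
by have [] := fE.1 (f p).
Qed.

Definition frame_coef p s (i : 'I_r) q : R^o :=
  (invmx (vframe E (f p) (f q)) *m s q) i 0.

Lemma frame_expand p s q : vdom E (f p) (f q) ->
  s q = \sum_i (frame_coef p s i q : R) *: local_frame E (f p) i (f q).
Proof.
move=> /fE.2 u; rewrite -[LHS](mulKVmx u); exact: mulmx_sum_col.
Qed.

Lemma near_frame_expand p s : \forall q \near p,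
  s q = \sum_i (frame_coef p s i q : R) *: local_frame E (f p) i (f q).
Proof. by apply: filterS (near_vdom p) => q; exact: frame_expand. Qed.

Lemma frame_coef_smooth p s i : smooth_sec f E s p ->
  smooth_at (frame_coef p s i) p.
Proof. by move=> /smooth_at_mxP/(_ i 0). Qed.

Lemma smooth_sec_eq p s t : (\forall q \near p, s q = t q) ->
  smooth_sec f E s p -> smooth_sec f E t p.
Proof. by move=> st; apply: smooth_at_eq; apply: filterS st => q ->. Qed.

Lemma smooth_secZ p (a : N -> R^o) s : smooth_at a p -> smooth_sec f E s p ->
  smooth_sec f E (fun q => (a q : R) *: s q) p.
Proof.
move=> sa ss; have := smooth_atZ sa ss; apply: smooth_near_ext => x.
by rewrite /= scalemxAr.
Qed.

Lemma smooth_sec0 p : smooth_sec f E (fun=> 0) p.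
Proof. by apply: smooth_near_ext (smooth_near_cst 0 _) => x; rewrite /= mulmx0. Qed.

Lemma smooth_sec_sum p (I : Type) (e : seq I) (S : I -> N -> 'cV[R]_r) :
  (forall i, smooth_sec f E (S i) p) ->
  smooth_sec f E (fun q => \sum_(i <- e) S i q) p.
Proof.
move=> sS; have := smooth_at_sum e sS; apply: smooth_near_ext => x.
by rewrite /= mulmx_sumr.
Qed.

Lemma smooth_sec_pull p (s : M -> 'cV[R]_r) : smooth_sec idfun E s (f p) ->
  smooth_sec f E (s \o f) p.
Proof. exact: (smooth_at_comp_mx sf). Qed.

End Frames.

Section LocalFrame.
Variables (R : realType) (m r : nat) (M : manifold R m).
Variables (E : vbundle M r) (fE : framed E).

Lemma local_frame_smooth x i : smooth_sec idfun E (local_frame E x i) x.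
Proof.
apply: smooth_at_eq (smooth_at_cst (delta_mx i 0) x).
have := near_vdom (@smooth_map_id _ _ M) fE x.
apply: filterS => q /fE.2 u; rewrite /local_frame colE mulKmx //.
Qed.

Lemma extend_vector x (u : 'cV[R]_r) :
  exists2 s : M -> 'cV[R]_r, smooth_sec idfun E s x & s x = u.
Proof.
exists (fun q => vframe E x q *m (invmx (vframe E x x) *m u)).
  apply: smooth_at_eq (smooth_at_cst (invmx (vframe E x x) *m u) x).
  have := near_vdom (@smooth_map_id _ _ M) fE x.
  by apply: filterS => q /fE.2 uq; rewrite mulKmx.
by apply: mulKVmx; apply: fE.2; case: (fE.1 x).
Qed.

End LocalFrame.

(** * Operators on germs of sections: locality, tensoriality, pull-back *)

Section Tensoriality.
Variables (R : realType) (n m r : nat) (N : manifold R n) (M : manifold R m).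
Variables (f : N -> M) (sf : smooth_map f).
Variables (E : vbundle M r) (fE : framed E) (p : N).
Implicit Types (s t : N -> 'cV[R]_r) (a : N -> R^o).

Definition additive_at (U : zmodType) (F : (N -> 'cV[R]_r) -> U) :=
  forall s t, smooth_sec f E s p -> smooth_sec f E t p ->
    F (fun q => s q + t q) = F s + F t.

Lemma additive_sum (U : zmodType) (F : (N -> 'cV[R]_r) -> U) (I : Type)
    (e : seq I) (S : I -> N -> 'cV[R]_r) :
  additive_at F -> (forall i, smooth_sec f E (S i) p) ->
  F (fun q => \sum_(i <- e) S i q) = \sum_(i <- e) F (S i).
Proof.
move=> FD sS; have F0 : F (fun=> 0) = 0.
  have := FD _ _ (smooth_sec0 f E p) (smooth_sec0 f E p).
  under [X in F X]funext do rewrite addr0.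
  by rewrite -{1}[F _]addr0 => /addrI.
elim: e => [|i e IH].
  by rewrite big_nil -[RHS]F0; congr F; apply/funext => q; rewrite big_nil.
rewrite big_cons -IH -FD //; last exact: smooth_sec_sum.
by congr F; apply/funext => q; rewrite big_cons.
Qed.

Definition tensorial (U : lmodType R) (F : (N -> 'cV[R]_r) -> U) :=
  additive_at F /\ forall a s, smooth_at a p -> smooth_sec f E s p ->
    F (fun q => (a q : R) *: s q) = (a p : R) *: F s.

(** A covariant derivative at the fixed [p] and [v], with no smooth dependence on them. Given
    connections and the pull-back of [DbS] built below share this notion. *)
Definition derivation v (F : (N -> 'cV[R]_r) -> 'cV[R]_r) :=
  additive_at F /\ forall a s, smooth_at a p -> smooth_sec f E s p ->
    F (fun q => (a q : R) *: s q) = dir p v a *: s p + (a p : R) *: F s.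

(* Regularity is only required of the germ at [p], so the indicator function of
   the set where two sections agree can serve as a cut-off function. *)
Lemma cutoff (U : zmodType) (F : (N -> 'cV[R]_r) -> U) s t :
  (forall a s, (\forall q \near p, a q = 1) -> smooth_sec f E s p ->
    F (fun q => (a q : R) *: s q) = F s) ->
  (\forall q \near p, s q = t q) -> smooth_sec f E s p -> F s = F t.
Proof.
move=> Fcut st ss; pose a q : R^o := if `[< s q = t q >] then 1 else 0.
have a1 : \forall q \near p, a q = 1.
  by apply: filterS st => q st; rewrite /a; case: asboolP.
rewrite -(Fcut a) // -[RHS](Fcut a) //; last exact: smooth_sec_eq ss.
by congr F; apply/funext => q; rewrite /a; case: asboolP => [->|]; rewrite ?scale0r.
Qed.

Lemma near1_smooth a : (\forall q \near p, a q = 1) -> smooth_at a p.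
Proof.
move=> a1; apply: smooth_at_eq (smooth_at_cst (1 : R^o) p).
by apply: filterS a1 => q ->.
Qed.

Lemma near1_self a : (\forall q \near p, a q = 1) -> a p = 1.
Proof. by move/nbhs_singleton. Qed.

Lemma derivation_local v F s t : derivation v F ->
  (\forall q \near p, s q = t q) -> smooth_sec f E s p -> F s = F t.
Proof.
move=> [_ FZ]; apply: cutoff => a u a1 su.
rewrite FZ ?(near1_self a1) //; last exact: near1_smooth.
by rewrite (dir_eq v (b := fun=> 1)) // dir_cst scale0r add0r scale1r.
Qed.

Section Tensor.
Variables (U : lmodType R) (F : (N -> 'cV[R]_r) -> U) (tF : tensorial F).

Lemma tensor_local s t :
  (\forall q \near p, s q = t q) -> smooth_sec f E s p -> F s = F t.
Proof.
case: tF => _ FZ; apply: cutoff => a u a1 su.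
by rewrite FZ ?(near1_self a1) ?scale1r //; exact: near1_smooth.
Qed.

Lemma tensor_expand s : smooth_sec f E s p ->
  F s = \sum_i (frame_coef f E p s i p : R) *: F (local_frame E (f p) i \o f).
Proof.
move=> ss; have sl i := smooth_sec_pull sf (local_frame_smooth fE (f p) i).
have sc i := frame_coef_smooth i ss.
rewrite (tensor_local (near_frame_expand sf fE p s)) // (additive_sum _ tF.1) => [|i].
  apply: eq_bigr => i _; exact: (tF.2 _ _ (sc i) (sl i)).
exact: smooth_secZ (sc i) (sl i).
Qed.

(** The frame used for the expansion is itself pulled back from [M], so it suffices to test
    pulled-back sections, on which the ambient rules are available. *)
Lemma tensor_eq0 s :
  (forall t : M -> 'cV[R]_r, smooth_sec idfun E t (f p) -> F (t \o f) = 0) ->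
  smooth_sec f E s p -> F s = 0.
Proof.
move=> F0 /tensor_expand ->; rewrite big1 // => i _.
by rewrite F0 ?scaler0 //; exact: local_frame_smooth.
Qed.

End Tensor.

Lemma tensor_mx k (F : (N -> 'cV[R]_r) -> 'cV[R]_k) : tensorial F ->
  exists A : 'M[R]_(k, r), forall s, smooth_sec f E s p -> F s = A *m s p.
Proof.
move=> tF.
exists (\matrix_(j, i) F (local_frame E (f p) i \o f) j 0 *m
          invmx (vframe E (f p) (f p))) => s ss.
rewrite (tensor_expand tF ss) -mulmxA [RHS]mulmx_sum_col.
apply: eq_bigr => i _; congr (_ *: _).
by apply/colP => j; rewrite !mxE.
Qed.

End Tensoriality.

Lemma connection_derivation (R : realType) (n m r : nat) (N : manifold R n)
    (M : manifold R m) (f : N -> M) (E : vbundle M r) (D : connection r N) p v :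
  is_connection f E D -> derivation f E p v (D p v).
Proof. by case=> _ DD DZ _; split=> [s t|a s]; [exact: DD|exact: DZ]. Qed.

(** The Leibniz rule dictates the formula: expand [s] in the frame pulled back from [M],
    differentiate the coefficients on [N], and the frame by [D] in the image direction. *)
Lemma pullback_derivation (R : realType) (n m r : nat) (N : manifold R n)
    (M : manifold R m) (f : N -> M) (E : vbundle M r) (D : connection r M) p v :
  smooth_map f -> framed E -> is_connection idfun E D ->
  exists F : (N -> 'cV[R]_r) -> 'cV[R]_r, derivation f E p v F /\
    forall s, smooth_sec idfun E s (f p) -> F (s \o f) = D (f p) (dmap f p *m v) s.
Proof.
move=> sf fE hD; set w := dmap f p *m v.
pose c := frame_coef f E p; pose l i := local_frame E (f p) i.
exists (fun s => \sum_i (dir p v (c s i) *: l i (f p)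
                         + (c s i p : R) *: D (f p) w (l i))).
have sc s i : smooth_sec f E s p -> smooth_at (c s i) p.
  exact: frame_coef_smooth.
split; first split=> [s t ss st|a s sa ss].
- rewrite -big_split; apply: eq_bigr => i _ /=.
  have cD : c (fun q => s q + t q) i = fun q => c s i q + c t i q.
    by apply/funext => q; rewrite /c /frame_coef mulmxDr mxE.
  by rewrite cD (dirD v (sc _ i ss) (sc _ i st)) /= !scalerDl addrACA.
- have pp : vdom E (f p) (f p) by case: (fE.1 (f p)).
  rewrite [in RHS](frame_expand fE s pp) !scaler_sumr -big_split.
  apply: eq_bigr => i _ /=.
  have cM : c (fun q => (a q : R) *: s q) i = fun q => a q * c s i q.
    by apply/funext => q; rewrite /c /frame_coef -scalemxAr mxE.
  rewrite cM (dirM v sa (sc _ i ss)) /=.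
  rewrite scalerDl scalerDr !scalerA [in RHS]addrA; congr (_ + _).
  by rewrite addrC [in RHS](mulrC (dir p v a)).
move=> s ss.
have dD := connection_derivation (f p) w hD.
have sl i : smooth_sec idfun E (l i) (f p) := local_frame_smooth fE (f p) i.
have sC i := frame_coef_smooth i ss.
rewrite (derivation_local dD (near_frame_expand (@smooth_map_id _ _ M) fE (f p) s) ss).
rewrite (additive_sum _ dD.1) => [|i]; last exact: smooth_secZ (sC i) (sl i).
apply: eq_bigr => i _; rewrite (dD.2 _ _ (sC i) (sl i)); congr (_ *: _ + _).
by rewrite -dir_comp.
Qed.

(** * Spinors in dimension seven *)

Section InnerProduct.
Variables (R : realType) (r : nat) (G : 'M[R]_r).
Implicit Types u v w : 'cV[R]_r.

Lemma ipDl u v w : ip G (u + v) w = ip G u w + ip G v w.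
Proof. by rewrite /ip linearD !mulmxDl mxE. Qed.

Lemma ipDr u v w : ip G u (v + w) = ip G u v + ip G u w.
Proof. by rewrite /ip mulmxDr mxE. Qed.

Lemma ipZl k u v : ip G (k *: u) v = k * ip G u v.
Proof. by rewrite /ip linearZ -!scalemxAl mxE. Qed.

Lemma ipZr k u v : ip G u (k *: v) = k * ip G u v.
Proof. by rewrite /ip -scalemxAr mxE. Qed.

Lemma ipNl u v : ip G (- u) v = - ip G u v.
Proof. by rewrite -scaleN1r ipZl mulN1r. Qed.

Lemma ipNr u v : ip G u (- v) = - ip G u v.
Proof. by rewrite -scaleN1r ipZr mulN1r. Qed.

Lemma ip0l u : ip G 0 u = 0.
Proof. by rewrite /ip trmx0 !mul0mx mxE. Qed.

Lemma ip0r u : ip G u 0 = 0.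
Proof. by rewrite /ip mulmx0 mxE. Qed.

Hypothesis Gs : G^T = G.

Lemma ipC u v : ip G u v = ip G v u.
Proof.
rewrite /ip; have -> : v^T *m G *m u = (u^T *m G *m v)^T.
  by rewrite !trmx_mul Gs trmxK mulmxA.
by rewrite [RHS]mxE.
Qed.

Hypothesis Gp : forall u, u != 0 -> 0 < ip G u u.

Lemma ip_eq0 u : ip G u u = 0 -> u = 0.
Proof.
by move=> u0; apply/eqP; apply: contraT => /Gp; rewrite u0 ltxx.
Qed.

Lemma ip_inj u v : (forall w, ip G u w = ip G v w) -> u = v.
Proof.
move=> uv; apply/eqP; rewrite -subr_eq0; apply/eqP/ip_eq0.
by rewrite {1}ipDl ipNl uv subrr.
Qed.

End InnerProduct.

Definition ipE := (ipDl, ipDr, ipZl, ipZr, ipNl, ipNr).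

Section ColumnEntries.
Variables (R : pzRingType) (r : nat) (u v : 'cV[R]_r) (k : 'I_r) (a : R).

Lemma col_addE : (u + v) k 0 = u k 0 + v k 0. Proof. exact: mxE. Qed.
Lemma col_oppE : (- u) k 0 = - u k 0. Proof. exact: mxE. Qed.
Lemma col_scaleE : (a *: u) k 0 = a * u k 0. Proof. exact: mxE. Qed.

End ColumnEntries.

Lemma col_entry (R : Type) r (u v : 'cV[R]_r) k : u = v -> u k 0 = v k 0.
Proof. by move->. Qed.

Definition colsE := (col_addE, col_oppE, col_scaleE).

Lemma unitmx_inj (R : realType) n (A : 'M[R]_n) :
  (forall u : 'cV_n, A *m u = 0 -> u = 0) -> A \in unitmx.
Proof.
move=> Ainj; rewrite -unitmx_tr unitmxE unitfE; apply/det0P => -[v v0 vA].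
case/eqP: v0; rewrite -[v]trmxK (Ainj v^T) ?trmx0 //.
by rewrite -[A]trmxK -trmx_mul vA trmx0.
Qed.

Lemma gram_unit (R : realType) r (G : 'M[R]_r) :
  (forall u, u != 0 -> 0 < ip G u u) -> G \in unitmx.
Proof.
move=> Gp; apply: unitmx_inj => u Gu; apply: (ip_eq0 Gp).
by rewrite /ip -mulmxA Gu mulmx0 mxE.
Qed.

Lemma orthogonal_ex (R : realType) r k (G : 'M[R]_r) (u : 'I_k -> 'cV[R]_r) :
  (k < r)%N -> exists2 X, X != 0 & forall i, ip G (u i) X = 0.
Proof.
move=> kr; pose K : 'M[R]_(r, k) := (\matrix_i ((u i)^T *m G))^T.
have : kermx K != 0.
  rewrite -mxrank_eq0 mxrank_ker -lt0n subn_gt0.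
  exact: leq_ltn_trans (rank_leq_col K) kr.
move=> /rowV0Pn[v /sub_kermxP vK v0]; exists v^T.
  by rewrite -trmx0 (inj_eq trmx_inj).
move=> i; have := congr1 (row i \o trmx) vK.
by rewrite /= trmx_mul trmxK row_mul rowK trmx0 row0 /ip => ->; rewrite mxE.
Qed.

Record spinor_module (R : realType) (G : 'M[R]_7) (H : 'M[R]_8)
    (c : 'cV[R]_7 -> 'M[R]_8) (phi : 'cV[R]_8) : Prop := SpinorModule {
  sm_gC : G^T = G;
  sm_g_gt0 : forall u, u != 0 -> 0 < ip G u u;
  sm_hC : H^T = H;
  sm_h_gt0 : forall u, u != 0 -> 0 < ip H u u;
  sm_linear : linear c;
  sm_sq : forall X, c X *m c X = (- ip G X X)%:M;
  sm_skew : forall X a b, ip H (c X *m a) b = - ip H a (c X *m b);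
  sm_unit : ip H phi phi = 1 }.

Section Spinor.
Variables (R : realType) (G : 'M[R]_7) (H : 'M[R]_8).
Variables (c : 'cV[R]_7 -> 'M[R]_8) (phi : 'cV[R]_8).
Hypothesis sm : spinor_module G H c phi.
Let Gs := sm_gC sm.
Let Gp := sm_g_gt0 sm.
Let Hs := sm_hC sm.
Let cL := sm_linear sm.
Let cc := sm_sq sm.
Let cH := sm_skew sm.
Let phi1 := sm_unit sm.
Implicit Types (X Y Z : 'cV[R]_7) (u w : 'cV[R]_8).

Lemma clD X Y u : c (X + Y) *m u = c X *m u + c Y *m u.
Proof. by rewrite -[X]scale1r cL !scale1r mulmxDl. Qed.

Lemma cl0 u : c 0 *m u = 0.
Proof. by have := clD 0 0 u; rewrite addr0 -{1}[c 0 *m u]addr0 => /addrI. Qed.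

Lemma clZ k X u : c (k *: X) *m u = k *: (c X *m u).
Proof. by rewrite -[k *: X]addr0 cL mulmxDl cl0 addr0 -scalemxAl. Qed.

Lemma clN X u : c (- X) *m u = - (c X *m u).
Proof. by rewrite -scaleN1r clZ scaleN1r. Qed.

Lemma clsq X u : c X *m (c X *m u) = - ip G X X *: u.
Proof. by rewrite mulmxA cc mul_scalar_mx. Qed.

Lemma clC X Y u :
  c X *m (c Y *m u) = - (c Y *m (c X *m u)) - (2 * ip G X Y) *: u.
Proof.
have := clsq (X + Y) u; rewrite !clD !mulmxDr !clsq !ipE (ipC Gs Y X) => E.
by apply/colP => k; have := congr1 (fun v : 'cV[R]_8 => v k 0) E; rewrite !colsE; lra.
Qed.

Lemma cl_phi0 X : ip H (c X *m phi) phi = 0.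
Proof. by have := cH X phi phi; rewrite (ipC Hs phi); lra. Qed.

Lemma cl_phi0r X : ip H phi (c X *m phi) = 0.
Proof. by rewrite ipC // cl_phi0. Qed.

Lemma cl_isom X Y u : ip H (c X *m u) (c Y *m u) = ip G X Y * ip H u u.
Proof.
have E1 := cH X u (c Y *m u); have E2 := cH Y u (c X *m u).
rewrite clC !ipE in E1; rewrite (ipC Hs (c Y *m u)) in E2.
lra.
Qed.

Lemma cl_unit_isom X u w : ip G X X = 1 -> ip H (c X *m u) (c X *m w) = ip H u w.
Proof. by move=> X1; rewrite cH clsq X1 scaleN1r ipNr opprK. Qed.

Lemma cl_phi_isom X Y : ip H (c X *m phi) (c Y *m phi) = ip G X Y.
Proof. by rewrite cl_isom phi1 mulr1. Qed.

Lemma cl_phi_inj X Y : c X *m phi = c Y *m phi -> X = Y.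
Proof.
by move=> XY; apply: (ip_inj Gp) => Z; rewrite -!cl_phi_isom XY.
Qed.

Lemma cl_phi_mx : exists Phi : 'M[R]_(8, 7), forall X, Phi *m X = c X *m phi.
Proof.
exists (\matrix_(i, j) (c (delta_mx j 0) *m phi) i 0) => X.
rewrite mulmx_sum_col [in RHS](matrix_sum_delta X).
have cs (I : Type) (r : seq I) (F : I -> 'cV[R]_7) :
    c (\sum_(i <- r) F i) *m phi = \sum_(i <- r) c (F i) *m phi.
  by elim: r => [|i r IH]; rewrite ?big_nil ?cl0 // !big_cons clD IH.
rewrite cs; apply: eq_bigr => j _; rewrite big_ord1 clZ; congr (_ *: _).
by apply/colP => i; rewrite !mxE.
Qed.

(** Dimension count [8 = 1 + 7]: [phi] is orthogonal to the image of the injective map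
    [X |-> X phi], so together they span. A matrix [L] is provided because [J], [S] and [eta] are
    built from it and must be linear. *)
Lemma spinor_mx : exists L : 'M[R]_(7, 8), forall u,
  u = ip H phi u *: phi + c (L *m u) *m phi.
Proof.
have [Phi PhiE] := cl_phi_mx.
pose K : 'M[R]_(8, 1 + 7) := row_mx phi Phi.
have KE (u : 'cV[R]_(1 + 7)) :
    K *m u = usubmx u 0 0 *: phi + c (dsubmx u) *m phi.
  rewrite -[in LHS](vsubmxK u) mul_row_col PhiE [usubmx u]mx11_scalar.
  by rewrite mul_mx_scalar !mxE.
have Kinj (u : 'cV[R]_(1 + 7)) : K *m u = 0 -> u = 0.
  rewrite KE => E; have a0 : usubmx u 0 0 = 0.
    have := congr1 (ip H phi) E.
    by rewrite !ipE cl_phi0r phi1 ip0r mulr1 addr0.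
  have d0 : dsubmx u = 0.
    by apply: cl_phi_inj; rewrite cl0 -E a0 scale0r add0r.
  rewrite -[u]vsubmxK d0 [usubmx _]mx11_scalar a0.
  by rewrite raddf0 col_mx0.
have Ku : (K : 'M[R]_8) \in unitmx := unitmx_inj Kinj.
pose I : 'M[R]_(1 + 7, 8) := invmx (K : 'M[R]_8).
exists (dsubmx I) => u.
have E : u = (usubmx I *m u) 0 0 *: phi + c (dsubmx I *m u) *m phi.
  by rewrite mul_usub_mx mul_dsub_mx -(KE (I *m u)) (mulKVmx Ku).
have e : ip H phi u = (usubmx I *m u) 0 0.
  by rewrite {1}E !ipE cl_phi0r phi1 mulr1 addr0.
by rewrite e -E.
Qed.

Lemma spinor_vec u : ip H u phi = 0 -> exists X, u = c X *m phi.
Proof.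
have [L LE] := spinor_mx => u0; exists (L *m u).
by rewrite [LHS]LE (ipC Hs) u0 scale0r add0r.
Qed.

Section CrossProduct.
Variable x : 'cV[R]_7 -> 'cV[R]_7 -> 'cV[R]_7.
Hypothesis xE : forall X Y Z,
  ip G (x X Y) Z = ip H (c X *m (c Y *m (c Z *m phi))) phi.

(** The right-hand side is orthogonal to [phi], hence of the form [U phi], and pairing with [Z phi]
    identifies [U]. The factors occur as [Y X] because moving [X] and [Y] across the inner product
    in [(X Y Z phi, phi)] reverses them. *)
Lemma cl_cross X Y : c (x X Y) *m phi = c Y *m (c X *m phi) + ip G X Y *: phi.
Proof.
have [|U UE] := @spinor_vec (c Y *m (c X *m phi) + ip G X Y *: phi).
  by rewrite !ipE phi1 cH cl_phi_isom; lra.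
rewrite UE; congr (c _ *m _); apply: (ip_inj Gp) => Z.
rewrite xE cH cH opprK -[RHS]cl_phi_isom -UE !ipE cl_phi0r mulr0 addr0.
by rewrite ipC.
Qed.

Lemma cross_skew Z X Y : ip G (x Z X) Y = - ip G X (x Z Y).
Proof.
rewrite -!cl_phi_isom !cl_cross !ipE cl_phi0 cl_phi0r.
have := cH X (c Z *m phi) (c Y *m phi); rewrite (clC X Y) !ipE cl_phi0.
have := cH Y (c X *m phi) (c Z *m phi); rewrite (ipC Hs (c Y *m _)).
lra.
Qed.

Lemma crossDr X Y Z : x X (Y + Z) = x X Y + x X Z.
Proof.
by apply: (ip_inj Gp) => U; rewrite ipDl !xE clD mulmxDr ipDl.
Qed.

(** Polarized form of [X x (X x Y) = g(X, Y) X - g(X, X) Y]. After [cl_cross] both sides are words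
    in [a], [X], [Y] acting on [phi], which the Clifford relations reorder; [A0] is an antisymmetry
    of the 3-form. *)
Lemma double_cross a X Y : x a (x X Y) + x X (x a Y)
  = - (2 * ip G a X) *: Y + ip G a Y *: X + ip G X Y *: a.
Proof.
apply: cl_phi_inj; rewrite !clD !clZ !cl_cross.
have E1 := clC (x X Y) a phi; have E2 := clC (x a Y) X phi.
have A0 : ip G (x X Y) a = - ip G (x a Y) X.
  have := cH Y (c X *m phi) (c a *m phi); have := cH Y (c a *m phi) (c X *m phi).
  rewrite -!cl_phi_isom !cl_cross !ipE !cl_phi0r (ipC Hs (c X *m phi)).
  lra.
rewrite cl_cross mulmxDr -scalemxAr A0 in E1.
rewrite cl_cross mulmxDr -scalemxAr in E2.
have E3 := clC X a (c Y *m phi); have E4 := clC X Y (c a *m phi).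
have E5 := congr1 (mulmx (c a)) (clC Y X phi).
have E6 := congr1 (mulmx (c X)) (clC Y a phi).
rewrite !mulmxBr !mulmxN -!scalemxAr in E5 E6.
rewrite E1 E2 (ipC Gs a) A0.
apply/colP => k; have := col_entry k E3; have := col_entry k E4.
have := col_entry k E5; have := col_entry k E6; rewrite !colsE.
rewrite (ipC Gs X (x a Y)) (ipC Gs Y a) (ipC Gs Y X) (ipC Gs X a).
lra.
Qed.

(* Apply [A] to [x X (x X Y) = g(X, Y) X - g(X, X) Y]. *)
Lemma derivation_skew A :
  (forall X Y, A *m x X Y = x (A *m X) Y + x X (A *m Y)) -> skew_endo G A.
Proof.
move=> dA.
have E X Y : (2 * ip G (A *m X) X) *: Y
    = (ip G (A *m X) Y + ip G X (A *m Y)) *: X.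
  have D1 := double_cross X X Y; have D2 := double_cross (A *m X) X Y.
  have D3 := double_cross X X (A *m Y).
  have := congr1 (mulmx A) D1.
  rewrite !mulmxDr -!scalemxAr !dA !crossDr => D4.
  apply/colP => k; move: (col_entry k D2) (col_entry k D3) (col_entry k D4).
  rewrite !colsE (ipC Gs _ X); lra.
(* By [E], every vector times [2 g(A X, X)] is a multiple of [X]. Two independent basis vectors
   cannot both be multiples of [X], so the factor vanishes. *)
have E0 X : ip G (A *m X) X = 0.
  pose e i : 'cV[R]_7 := delta_mx i 0.
  have Ei i j := col_entry j (E X (e i)).
  pose i0 : 'I_7 := ord0; pose i1 : 'I_7 := lift ord0 ord0.
  move: (Ei i0 i0) (Ei i0 i1) (Ei i1 i0) (Ei i1 i1); rewrite !colsE !mxE /=.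
  rewrite !mulr1 !mulr0; set b0 := _ + _; set b1 := _ + _.
  move=> h00 h01 h10 h11.
  have : (2 * ip G (A *m X) X) * (2 * ip G (A *m X) X) = 0.
    by rewrite {1}h00 h11 mulrACA [X i0 0 * _]mulrC mulrACA -h01 mul0r.
  by move/eqP; rewrite mulf_eq0 orbb mulf_eq0 pnatr_eq0 => /eqP.
move=> X Y; have := E0 (X + Y); rewrite mulmxDr !ipE !E0 (ipC Gs _ X); lra.
Qed.

End CrossProduct.

(* [B] commutes with all products of two vectors.  If [B phi = Y phi] with
   [Y != 0], choose [X], [Z] such that [X Y Z phi = W phi] with [W] orthogonal
   to [Y]; then [W X Y Z] maps [phi] to [- |W|^2 phi] and anticommutes with [Y],
   which is incompatible with commuting with [B]. *)
Lemma skew_commutant V (B : 'M[R]_8) : ip G V V = 1 ->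
  (forall X u, ip G X V = 0 ->
    B *m (c V *m (c X *m u)) = c V *m (c X *m (B *m u))) ->
  (forall u w, ip H (B *m u) w = - ip H u (B *m w)) ->
  B *m phi = 0.
Proof.
move=> V1 BV Bskew.
have cVV u : c V *m (c V *m u) = - u by rewrite clsq V1 scaleN1r.
(* A normal part of [X] may be added because [V V = -1] commutes with [B]. *)
have {}BV X u : B *m (c V *m (c X *m u)) = c V *m (c X *m (B *m u)).
  have [X' [t [-> X'V]]] : exists X' t, X = X' + t *: V /\ ip G X' V = 0.
    exists (X - ip G X V *: V), (ip G X V); split; first by rewrite subrK.
    by rewrite !ipE V1 mulr1 subrr.
  by rewrite !clD !clZ !mulmxDr -!scalemxAr !cVV mulmxN BV.
have BB X Z u : B *m (c X *m (c Z *m u)) = c X *m (c Z *m (B *m u)).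
  (* [X Z = - X V V Z] and [- X V = V X + 2 g(V, X)]: every product of two vectors reduces to
     products starting with [V]. *)
  have E w : c X *m (c Z *m w)
      = c V *m (c X *m (c V *m (c Z *m w))) + (2 * ip G V X) *: (c V *m (c Z *m w)).
    rewrite (clC X V) mulmxBr mulmxN cVV -scalemxAr (ipC Gs X V).
    by rewrite opprK subrK.
  by rewrite !E mulmxDr -scalemxAr !BV.
have [Y YE] : exists Y, B *m phi = c Y *m phi.
  by apply: spinor_vec; have := Bskew phi phi; rewrite (ipC Hs phi); lra.
rewrite YE; apply/eqP; apply: contraT => cY0.
have {cY0} Y0 : Y != 0 by apply: contra cY0 => /eqP->; rewrite cl0.
have [//|X X0 XY] := orthogonal_ex G (k := 1) (fun=> Y).
have {}XY : ip G Y X = 0 := XY 0.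
have [|w wE] := @spinor_vec (c Y *m (c X *m phi)).
  by rewrite cH cl_phi_isom (ipC Gs) XY oppr0.
(* Orthogonality of [Z] to [w] makes [X Y Z phi] orthogonal to [phi], orthogonality to [X] gives [W]
   orthogonal to [Y], and orthogonality to [Y] lets [Y] anticommute with [Z]. *)
pose us (i : 'I_3) := if i == 0 then X else if i == 1 then Y else w.
have [//|Z Z0 Zus] := orthogonal_ex G us.
have XZ : ip G X Z = 0 := Zus 0.
have YZ : ip G Y Z = 0 := Zus 1.
have wZ : ip G w Z = 0 := Zus 2.
have [|W WE] := @spinor_vec (c X *m (c Y *m (c Z *m phi))).
  by rewrite cH cH opprK wE cl_phi_isom ipC.
have anti X1 X2 u : ip G X1 X2 = 0 -> c X1 *m (c X2 *m u) = - (c X2 *m (c X1 *m u)).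
  by move=> X12; rewrite clC X12 mulr0 scale0r subr0.
have YW : ip G Y W = 0.
  rewrite ipC // -cl_phi_isom -WE (anti X Y) ?(ipC Gs X) // ipNl cH clsq ipZr.
  by rewrite cH cl_phi_isom (ipC Gs Z) XZ oppr0 mulr0 !oppr0.
have W0 : ip G W W != 0.
  rewrite -cl_phi_isom -WE !cl_isom phi1 mulr1 !mulf_neq0 //; exact/lt0r_neq0/Gp.
have := BB W X (c Y *m (c Z *m phi)); rewrite WE clsq -scalemxAr YE BB YE.
have ZY : ip G Z Y = 0 by rewrite ipC.
have XY' : ip G X Y = 0 by rewrite ipC.
have WY : ip G W Y = 0 by rewrite ipC.
rewrite (anti Z Y) // !mulmxN (anti X Y) // mulmxN opprK WE (anti W Y) // clsq.
rewrite -scalemxAr scaleNr opprK => E.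
have {}E : (2 * ip G W W) *: (c Y *m phi) = 0.
  by rewrite mulr_natl mulr2n scalerDl -{1}E addNr.
have Y1 : c Y *m phi = 0.
  by move/eqP: E; rewrite scaler_eq0 mulf_eq0 pnatr_eq0 (negPf W0) => /eqP.
by case/eqP: Y0; apply: cl_phi_inj; rewrite cl0.
Qed.

End Spinor.

Lemma mx_ext (R : pzRingType) m n (A B : 'M[R]_(m, n)) :
  (forall X : 'cV_n, A *m X = B *m X) -> A = B.
Proof.
by move=> AB; apply/matrixP => i j; have := AB (delta_mx j 0);
  rewrite -!colE => /colP/(_ i); rewrite !mxE.
Qed.

(** * The SU(3) modules *)

Section Adjoint.
Variables (R : realType) (r : nat) (g : 'M[R]_r).
Implicit Types A B : 'M[R]_r.

(** Treats symmetric maps ([A' = A]) and skew maps ([A' = - A]) at once. *)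
Definition adjoint_endo A A' := forall X Y, ip g (A *m X) Y = ip g X (A' *m Y).

Lemma adjointM A A' B B' : adjoint_endo A A' -> adjoint_endo B B' ->
  adjoint_endo (A *m B) (B' *m A').
Proof. by move=> aA aB X Y; rewrite -!mulmxA aA aB. Qed.

Lemma adjointD A A' B B' : adjoint_endo A A' -> adjoint_endo B B' ->
  adjoint_endo (A + B) (A' + B').
Proof. by move=> aA aB X Y; rewrite !mulmxDl !ipE aA aB. Qed.

Lemma adjointZ k A A' : adjoint_endo A A' -> adjoint_endo (k *: A) (k *: A').
Proof. by move=> aA X Y; rewrite -!scalemxAl !ipE aA. Qed.

Lemma adjointN A A' : adjoint_endo A A' -> adjoint_endo (- A) (- A').
Proof. by move=> aA X Y; rewrite !mulNmx !ipE aA. Qed.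

Lemma adjoint_scalar k : adjoint_endo k%:M k%:M.
Proof. by move=> X Y; rewrite !mul_scalar_mx !ipE. Qed.

Lemma skew_adjoint A : skew_endo g A <-> adjoint_endo A (- A).
Proof.
by split=> sA X Y; have := sA X Y; rewrite mulNmx ipNr.
Qed.

End Adjoint.

Section SU3Decomposition.
Variables (R : realType) (g J : 'M[R]_6).
Hypothesis J2 : J *m J = (- 1)%:M.
Hypothesis Jg : forall X Y, ip g (J *m X) (J *m Y) = ip g X Y.
Implicit Types (S T W : 'M[R]_6) (eta : 'rV[R]_6).

Lemma J2K n (A : 'M[R]_(6, n)) : J *m (J *m A) = - A.
Proof. by rewrite mulmxA J2 mul_scalar_mx scaleN1r. Qed.

Lemma adjoint_J : adjoint_endo g J (- J).
Proof.
by move=> X Y; rewrite -(Jg X) mulmxA mulmxN J2 raddfN /= opprK mul1mx.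
Qed.

Lemma su3_class0 c : in_su3_class g J c 0 0.
Proof.
have s0 : symmetric_endo g 0 by move=> X Y; rewrite !mul0mx ip0l ip0r.
have k0 : skew_endo g 0 by move=> X Y; rewrite !mul0mx ip0l ip0r oppr0.
by case: c; rewrite /= ?mul0mx ?mulmx0 ?oppr0 ?linear0; split=> //; exists 0;
  rewrite ?scale0r ?raddf0.
Qed.

Lemma su3_classD c S eta S' eta' : in_su3_class g J c S eta ->
  in_su3_class g J c S' eta' -> in_su3_class g J c (S + S') (eta + eta').
Proof.
have sD A A' : symmetric_endo g A -> symmetric_endo g A' ->
    symmetric_endo g (A + A') by exact: adjointD.
have kD A A' : skew_endo g A -> skew_endo g A' -> skew_endo g (A + A').
  by move=> kA kA' X Y; rewrite !mulmxDl !ipE kA kA' opprD.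
case: c => /=.
- move=> [[k ->] ->] [[k' ->] ->]; split; last exact: addr0.
  by exists (k + k'); rewrite scalerDl.
- move=> [[k ->] ->] [[k' ->] ->]; split; last exact: addr0.
  by exists (k + k'); rewrite raddfD.
- move=> [k1 c1 t1 ->] [k2 c2 t2 ->]; split; [exact: kD| | |exact: addr0].
  + by rewrite mulmxDl mulmxDr c1 c2.
  + by rewrite mulmxDr linearD /= t1 t2 addr0.
- move=> [s1 t1 c1 ->] [s2 t2 c2 ->]; split; [exact: sD| | |exact: addr0].
  + by rewrite linearD /= t1 t2 addr0.
  + by rewrite mulmxDl mulmxDr c1 c2.
- move=> [s1 t1 c1 ->] [s2 t2 c2 ->]; split; [exact: sD| | |exact: addr0].
  + by rewrite linearD /= t1 t2 addr0.
  + by rewrite mulmxDl mulmxDr c1 c2 opprD.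
- move=> [k1 c1 ->] [k2 c2 ->]; split; [exact: kD| |exact: addr0].
  by rewrite mulmxDl mulmxDr c1 c2 opprD.
- by move=> -> ->; rewrite addr0.
Qed.

Lemma su3_sum0 l : in_su3_sum g J l 0 0.
Proof.
elim: l => [|c l IH] //=; exists 0, 0, 0, 0.
by rewrite !addr0; split=> //; exact: su3_class0.
Qed.

Lemma su3_sumD l S eta S' eta' : in_su3_sum g J l S eta ->
  in_su3_sum g J l S' eta' -> in_su3_sum g J l (S + S') (eta + eta').
Proof.
elim: l S eta S' eta' => [|c l IH] S eta S' eta' /=.
  by move=> [-> ->] [-> ->]; rewrite !addr0.
move=> [S1 [e1 [S2 [e2 [-> -> c1 l2]]]]] [S3 [e3 [S4 [e4 [-> -> c3 l4]]]]].
exists (S1 + S3), (e1 + e3), (S2 + S4), (e2 + e4).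
by rewrite (addrACA S1 S2) (addrACA e1 e2); split=> //; [exact: su3_classD|exact: IH].
Qed.

(** Valued in [Prop] so that membership in a concrete table entry computes to a disjunction within
    reach of [tauto]. *)
Fixpoint su3_mem (c : su3_class) (l : seq su3_class) : Prop :=
  if l is c' :: l' then c = c' \/ su3_mem c l' else False.

Lemma su3_sum_mem c l S eta : su3_mem c l -> in_su3_class g J c S eta ->
  in_su3_sum g J l S eta.
Proof.
move=> + cS; elim: l => [|c' l IH] //= [<-|/IH lS].
  by exists S, eta, 0, 0; rewrite !addr0; split=> //; exact: su3_sum0.
by exists 0, 0, S, eta; rewrite !add0r; split=> //; exact: su3_class0.
Qed.

(** [chi1b], [chi2b] and [chi3] make up the symmetric maps and match types one to three; each occurs
    in every entry of its row. *)
Lemma weingarten_part t a W : in_weingarten_type g J t W ->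
  in_su3_sum g J (su3_table t a) (2^-1 *: W) 0.
Proof.
case: t => /=.
- by move=> ->; rewrite scaler0; exact: su3_sum0.
- move=> [k ->]; apply: (@su3_sum_mem chi1b); first by case: a => /=; tauto.
  by split=> //; exists (2^-1 * k); rewrite scale_scalar_mx.
- move=> [sW tW WJ]; apply: (@su3_sum_mem chi2b); first by case: a => /=; tauto.
  split=> //; first exact: adjointZ.
    by rewrite linearZ /= tW mulr0.
  by rewrite -scalemxAl -scalemxAr WJ.
- move=> [sW tW WJ]; apply: (@su3_sum_mem chi3); first by case: a => /=; tauto.
  split=> //; first exact: adjointZ.
    by rewrite linearZ /= tW mulr0.
  by rewrite -scalemxAl -scalemxAr WJ scalerN.
Qed.

(* [- J T = - (P T + Q T) / 2], where [P T] commutes and [Q T] anticommutes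
   with [J]. *)
Let P T := J *m T + T *m J.
Let Q T := J *m T - T *m J.

Lemma JT_split T : - (J *m T) = - 2^-1 *: P T + - 2^-1 *: Q T.
Proof.
rewrite /P /Q; move: (J *m T) (T *m J) => A B.
by apply/matrixP => i j; rewrite !mxE; field.
Qed.

Lemma P_comm T : P T *m J = J *m P T.
Proof. by rewrite mulmxDl mulmxDr -!mulmxA J2 J2K mul_mx_scalar scaleN1r addrC. Qed.

Lemma Q_anticomm T : Q T *m J = - (J *m Q T).
Proof.
rewrite mulmxBl mulmxBr -!mulmxA J2 J2K mul_mx_scalar scaleN1r opprB.
by rewrite opprK addrC.
Qed.

Lemma tr_Q T : \tr (Q T) = 0.
Proof. by rewrite linearB /= mxtrace_mulC subrr. Qed.

Lemma tr_JP T : \tr (J *m P T) = - (2 * \tr T).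
Proof.
rewrite mulmxDr J2K linearD /= [\tr (J *m (T *m J))]mxtrace_mulC -mulmxA J2.
by rewrite mul_mx_scalar scaleN1r linearN /=; ring.
Qed.

(** As [J] is skew, the adjoint of [J T] is [- T' J]. So the sum [J T + T J] changes sign under
    adjunction, while the difference [J T - T J] does not. *)
Lemma adjoint_P T T' : adjoint_endo g T T' -> adjoint_endo g (P T) (- P T').
Proof.
move=> aT; have -> : - P T' = T' *m - J + - J *m T'.
  by rewrite mulmxN mulNmx -opprD addrC.
exact: adjointD (adjointM adjoint_J aT) (adjointM aT adjoint_J).
Qed.

Lemma adjoint_Q T T' : adjoint_endo g T T' -> adjoint_endo g (Q T) (Q T').
Proof.
move=> aT; have -> : Q T' = T' *m - J + - (- J *m T').
  by rewrite mulmxN mulNmx opprK addrC.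
exact: adjointD (adjointM adjoint_J aT) (adjointN (adjointM aT adjoint_J)).
Qed.

Lemma eta_part t a eta : a <> W1 -> in_su3_sum g J (su3_table t a) 0 eta.
Proof.
by move=> aW; apply: (@su3_sum_mem chi5) => //; case: t a aW => [] [] /=; tauto.
Qed.

Lemma su3_sum_W1 t k : in_su3_sum g J (su3_table t W1) (- (J *m k%:M)) 0.
Proof.
apply: (@su3_sum_mem chi1); first by case: t => /=; tauto.
by split=> //; exists (- k); rewrite mul_mx_scalar scaleNr.
Qed.

Lemma su3_sum_W2 t T eta : skew_endo g T ->
  in_su3_sum g J (su3_table t W2) (- (J *m T)) eta.
Proof.
move=> /skew_adjoint aT; rewrite JT_split.
have aP : symmetric_endo g (- 2^-1 *: P T).
  have := adjointZ (- 2^-1) (adjoint_P aT).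
  by rewrite /P mulmxN mulNmx -opprD opprK.
have aQ : skew_endo g (- 2^-1 *: Q T).
  apply/skew_adjoint; have := adjointZ (- 2^-1) (adjoint_Q aT).
  by rewrite -scalerN /Q mulmxN mulNmx opprD.
have AJ : - 2^-1 *: P T *m J = J *m (- 2^-1 *: P T).
  by rewrite -scalemxAl -scalemxAr P_comm.
(* [k] is the trace part of the symmetric [A] in dimension six: it goes to [chi1b], the rest to
   [chi2b]. The final 0 is the [S] of [chi5], which carries all of [eta]. *)
move: aP AJ; move: (- 2^-1 *: P T) => A aP AJ; pose k := \tr A / 6.
have -> : A + - 2^-1 *: Q T = (A - k%:M) + (k%:M + (- 2^-1 *: Q T + 0)).
  by rewrite addr0 addrA subrK.
rewrite -[eta]add0r -[eta]add0r -[eta]add0r; apply: su3_sumD.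
  apply: (@su3_sum_mem chi2b); first by case: t => /=; tauto.
  split=> //.
  - by apply: adjointD => //; apply: adjointN; exact: adjoint_scalar.
  - by rewrite linearB /= mxtrace_scalar -mulr_natr divfK ?subrr // pnatr_eq0.
  - by rewrite mulmxBl mulmxBr AJ scalar_mxC.
apply: su3_sumD.
  by apply: (@su3_sum_mem chi1b); [case: t => /=; tauto|split=> //; exists k].
apply: su3_sumD; last exact: eta_part.
apply: (@su3_sum_mem chi4); first by case: t => /=; tauto.
by split=> //; rewrite -scalemxAl -scalemxAr Q_anticomm scalerN.
Qed.

Lemma su3_sum_W3 t T eta : symmetric_endo g T ->
  in_su3_sum g J (su3_table t W3) (- (J *m T)) eta.
Proof.
move=> aT; rewrite JT_split.
have aP : skew_endo g (- 2^-1 *: P T).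
  by apply/skew_adjoint; have := adjointZ (- 2^-1) (adjoint_P aT); rewrite scalerN.
have aQ : symmetric_endo g (- 2^-1 *: Q T) by exact: adjointZ (adjoint_Q aT).
have AJ : - 2^-1 *: P T *m J = J *m (- 2^-1 *: P T).
  by rewrite -scalemxAl -scalemxAr P_comm.
have tA : \tr (J *m (- 2^-1 *: P T)) = \tr T.
  by rewrite -scalemxAr linearZ /= tr_JP; field.
move: aP AJ tA; move: (- 2^-1 *: P T) => A aP AJ tA.
(* Since [tr (J A) = tr T] and [tr (J J) = -6], this [k] makes [tr (J (A - k J))] vanish, as [chi2]
   requires. *)
pose k := - (\tr T / 6).
have -> : A + - 2^-1 *: Q T = (A - k *: J) + (k *: J + (- 2^-1 *: Q T + 0)).
  by rewrite addr0 addrA subrK.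
rewrite -[eta]add0r -[eta]add0r -[eta]add0r; apply: su3_sumD.
  apply: (@su3_sum_mem chi2); first by case: t => /=; tauto.
  split=> //.
  - have E : - (A + - k *: J) = - A + - k *: - J by rewrite opprD scalerN.
    apply/skew_adjoint; rewrite -scaleNr E.
    exact: adjointD ((skew_adjoint _ _).1 aP) (adjointZ (- k) adjoint_J).
  - by rewrite mulmxBl mulmxBr AJ -!scalemxAl -scalemxAr.
  - rewrite mulmxBr linearB /= tA -scalemxAr J2 linearZ /= mxtrace_scalar /k.
    by field.
apply: su3_sumD.
  by apply: (@su3_sum_mem chi1); [case: t => /=; tauto|split=> //; exists k].
apply: su3_sumD; last exact: eta_part.
apply: (@su3_sum_mem chi3); first by case: t => /=; tauto.
split=> //; first by rewrite linearZ /= tr_Q mulr0.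
by rewrite -scalemxAl -scalemxAr Q_anticomm scalerN.
Qed.

Lemma su3_sum_W4 t a T eta : skew_endo g T -> T *m J = - (J *m T) ->
  in_su3_sum g J (su3_table t W4) (- (J *m (T - a *: J))) eta.
Proof.
move=> kT TJ.
have -> : - (J *m (T - a *: J)) = (- a)%:M + (- (J *m T) + 0).
  by rewrite mulmxBr -scalemxAr J2 scale_scalar_mx mulrN1 opprB addr0.
rewrite -[eta]add0r -[eta]add0r; apply: su3_sumD.
  by apply: (@su3_sum_mem chi1b); [case: t => /=; tauto|split=> //; exists (- a)].
apply: su3_sumD; last exact: eta_part.
apply: (@su3_sum_mem chi4); first by case: t => /=; tauto.
split=> //.
  apply/skew_adjoint; have := adjointN (adjointM adjoint_J ((skew_adjoint _ _).1 kT)).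
  by rewrite mulmxN mulNmx opprK TJ.
by rewrite mulNmx -mulmxA TJ !mulmxN !opprK.
Qed.

End SU3Decomposition.

(** * Hyperplanes *)

Section Hyperplane.
Variables (R : realType) (G : 'M[R]_7) (H : 'M[R]_8).
Variables (c : 'cV[R]_7 -> 'M[R]_8) (phi : 'cV[R]_8).
Hypothesis sm : spinor_module G H c phi.
Variables (d : 'M[R]_(7, 6)) (V : 'cV[R]_7).
Hypothesis drank : \rank d = 6.
Hypothesis V1 : ip G V V = 1.
Hypothesis dV : forall X, ip G (d *m X) V = 0.
Implicit Types (X Y : 'cV[R]_6) (Z : 'cV[R]_7).
Let Gs := sm_gC sm.
Let Gp := sm_g_gt0 sm.
Let Hs := sm_hC sm.
Let cH := sm_skew sm.

Let g := d^T *m G *m d.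

Lemma ip_induced X Y : ip g X Y = ip G (d *m X) (d *m Y).
Proof. by rewrite /ip trmx_mul !mulmxA. Qed.

Lemma hyper_inj X Y : d *m X = d *m Y -> X = Y.
Proof.
have df : row_full d by rewrite /row_full drank.
by move=> /(congr1 (mulmx (pinvmx d))); rewrite !mulmxA mulVpmx // !mul1mx.
Qed.

Lemma induced_sym : g^T = g.
Proof. by rewrite /g !trmx_mul trmxK Gs mulmxA. Qed.

Lemma induced_gt0 X : X != 0 -> 0 < ip g X X.
Proof.
move=> X0; rewrite ip_induced; apply: Gp; apply: contra X0 => /eqP dX.
by apply/eqP; apply: hyper_inj; rewrite dX mulmx0.
Qed.

Lemma hyper_normal_inj X (t : R) : d *m X + t *: V = 0 -> X = 0 /\ t = 0.
Proof.
move=> E; have t0 : t = 0.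
  have := congr1 (fun u => ip G u V) E.
  by rewrite !ipE dV V1 ip0l mulr1 add0r.
split=> //; apply: hyper_inj; rewrite mulmx0 -[RHS]E t0.
by rewrite scale0r addr0.
Qed.

Lemma hyper_decomp Z : exists X, Z = d *m X + ip G Z V *: V.
Proof.
pose K : 'M[R]_(7, 6 + 1) := row_mx d V.
have KE (u : 'cV[R]_(6 + 1)) : K *m u = d *m usubmx u + dsubmx u 0 0 *: V.
  rewrite -[in LHS](vsubmxK u) mul_row_col [dsubmx u in LHS]mx11_scalar.
  by rewrite mul_mx_scalar.
have Kinj (u : 'cV[R]_(6 + 1)) : K *m u = 0 -> u = 0.
  rewrite KE => /hyper_normal_inj[u0 v0].
  by rewrite -[u]vsubmxK u0 [dsubmx _]mx11_scalar v0 raddf0 col_mx0.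
have Ku : (K : 'M[R]_7) \in unitmx := unitmx_inj Kinj.
pose u : 'cV[R]_(6 + 1) := invmx (K : 'M[R]_7) *m Z.
have E : Z = d *m usubmx u + dsubmx u 0 0 *: V by rewrite -KE /u (mulKVmx Ku).
exists (usubmx u); rewrite {2}E !ipE dV V1 add0r mulr1; exact: E.
Qed.

(** [P] is the adjoint [g^-1 d^T G] of the isometric embedding [d], that is, the orthogonal
    projection onto the tangent space. *)
Lemma hyper_proj_ex : exists P : 'M[R]_(6, 7), forall X Z,
  ip g (P *m Z) X = ip G Z (d *m X).
Proof.
exists (invmx g *m d^T *m G) => X Z.
have gu : g \in unitmx := gram_unit induced_gt0.
rewrite (ipC induced_sym) (ipC Gs) /ip -mulmxA -!(mulmxA (invmx g)) mulKVmx //.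
by rewrite trmx_mul !mulmxA.
Qed.

Section Projection.
Variable P : 'M[R]_(6, 7).
Hypothesis hyper_proj_adj : forall X Z, ip g (P *m Z) X = ip G Z (d *m X).

Lemma hyper_proj_adjr X Z : ip g X (P *m Z) = ip G (d *m X) Z.
Proof. by rewrite (ipC induced_sym) hyper_proj_adj (ipC Gs). Qed.

Lemma hyper_projK X : P *m (d *m X) = X.
Proof.
by apply: (ip_inj induced_gt0) => Y; rewrite hyper_proj_adj ip_induced.
Qed.

Lemma hyper_projV : P *m V = 0.
Proof.
by apply: (ip_inj induced_gt0) => Y; rewrite hyper_proj_adj (ipC Gs) dV ip0l.
Qed.

Lemma hyper_projE Z : Z = d *m (P *m Z) + ip G Z V *: V.
Proof.
have [X XE] := hyper_decomp Z.
by rewrite {2}XE mulmxDr hyper_projK -scalemxAr hyper_projV scaler0 addr0.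
Qed.

(* [(J X) . phi = j (X . phi)] for the Clifford multiplication [X . phi = V X phi]
   of the hypersurface and [j = V], after cancelling [V]. *)
Definition is_acs (J : 'M[R]_6) := forall X,
  c (d *m (J *m X)) *m phi = c V *m (c (d *m X) *m phi).

Lemma acs_ex : exists J, is_acs J.
Proof.
have [Phi PhiE] := cl_phi_mx sm; have [L LE] := spinor_mx sm.
(* [L] recovers the vector whose product with [phi] is [V (d X) phi]. That vector is orthogonal to
   [V], so [P] loses nothing. *)
exists (P *m L *m c V *m Phi *m d) => X.
set u := c V *m (c (d *m X) *m phi).
have uphi : ip H phi u = 0.
  by rewrite (ipC Hs) cH (cl_phi_isom sm) dV oppr0.
have uE : c (L *m u) *m phi = u by rewrite [RHS]LE uphi scale0r add0r.
have uV : ip G (L *m u) V = 0.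
  rewrite -(cl_phi_isom sm) uE (cl_unit_isom sm) //.
  by rewrite (cl_phi0 sm).
have -> : P *m L *m c V *m Phi *m d *m X = P *m (L *m u).
  by rewrite -!mulmxA PhiE.
by rewrite -[in RHS]uE [in RHS](hyper_projE (L *m u)) uV scale0r addr0.
Qed.

Section ACS.
Variable J : 'M[R]_6.
Hypothesis JE : is_acs J.

Lemma acs_sq : J *m J = (- 1)%:M.
Proof.
apply: mx_ext => X; apply: hyper_inj; apply: (cl_phi_inj sm).
rewrite -mulmxA !JE (clsq sm) V1 mul_scalar_mx !scaleN1r mulmxN.
by rewrite (clN sm).
Qed.

Lemma acs_isom X Y : ip g (J *m X) (J *m Y) = ip g X Y.
Proof.
by rewrite !ip_induced -!(cl_phi_isom sm) !JE (cl_unit_isom sm).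
Qed.

(** A spinor orthogonal to [phi] is [Z phi]. The normal part of [Z] gives [eta], and the tangential
    part gives [S] after undoing [J]. *)
Lemma su3_tensors_ex (N : 'M[R]_(8, 6)) : (forall X, ip H (N *m X) phi = 0) ->
  exists (S : 'M[R]_6) (eta : 'rV[R]_6), forall X,
    N *m X = (eta *m X) 0 0 *: (c V *m phi)
             + c V *m (c (d *m (S *m X)) *m phi).
Proof.
move=> Nphi; have [L LE] := spinor_mx sm.
exists (- (J *m P *m L *m N)), (V^T *m G *m L *m N) => X.
have {1}-> : N *m X = c (L *m (N *m X)) *m phi.
  by rewrite [LHS]LE (ipC Hs) Nphi scale0r add0r.
set Z := L *m (N *m X).
rewrite -JE mulNmx mulmxN.
have -> : J *m (J *m P *m L *m N *m X) = - (P *m Z).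
  by rewrite !mulmxA acs_sq mul_scalar_mx scaleN1r !mulNmx -!mulmxA.
rewrite opprK {1}(hyper_projE Z) (clD sm) (clZ sm) addrC; congr (_ *: _ + _).
by rewrite (ipC Gs) /ip /Z !mulmxA.
Qed.

Lemma su3_tensorsE (S W : 'M[R]_6) (eta : 'rV[R]_6) (A : 'M[R]_7) :
  (forall X, (eta *m X) 0 0 *: (c V *m phi) + c V *m (c (d *m (S *m X)) *m phi)
    = c (A *m (d *m X)) *m phi + 2^-1 *: (c V *m (c (d *m (W *m X)) *m phi))) ->
  S = - (J *m (P *m A *m d)) + 2^-1 *: W /\
  forall X, (eta *m X) 0 0 = ip G (A *m (d *m X)) V.
Proof.
move=> E.
have E' X : (eta *m X) 0 0 *: V + d *m (J *m (S *m X))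
    = A *m (d *m X) + 2^-1 *: (d *m (J *m (W *m X))).
  by apply: (cl_phi_inj sm); rewrite !(clD sm) !(clZ sm) !JE.
split=> [|X]; last first.
  have := congr1 (fun u => ip G u V) (E' X).
  by rewrite !ipE !dV V1 mulr1 mulr0 !addr0.
apply: mx_ext => X; have := congr1 (mulmx J \o mulmx P) (E' X).
rewrite /= !mulmxDr -!scalemxAr hyper_projV !hyper_projK mulmx0 scaler0 add0r.
rewrite !(J2K acs_sq) scalerN => /(congr1 -%R); rewrite opprK opprD opprK => ->.
by rewrite mulmxDl mulNmx -scalemxAl !mulmxA.
Qed.

Section W4.
Variable x : 'cV[R]_7 -> 'cV[R]_7 -> 'cV[R]_7.
Hypothesis xE : forall X Y Z : 'cV[R]_7,
  ip G (x X Y) Z = ip H (c X *m (c Y *m (c Z *m phi))) phi.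

Lemma tangential_skew A : skew_endo G A -> skew_endo g (P *m A *m d).
Proof.
by move=> kA X Y; rewrite -!mulmxA hyper_proj_adj hyper_proj_adjr kA.
Qed.

Lemma tangential_sym A : symmetric_endo G A -> symmetric_endo g (P *m A *m d).
Proof.
by move=> kA X Y; rewrite -!mulmxA hyper_proj_adj hyper_proj_adjr kA.
Qed.

Lemma tangential_cross (A : 'M[R]_7) Z :
  (forall Y : 'cV[R]_7, A *m Y = x Z Y) ->
  exists T, [/\ P *m A *m d = T - ip G Z V *: J, skew_endo g T &
    T *m J = - (J *m T)].
Proof.
move=> AE; set a := ip G Z V.
have kA : skew_endo G A by move=> X Y; rewrite !AE (cross_skew sm xE).
exists (P *m A *m d + a *: J); split; first by rewrite addrK.
  move=> X Y; rewrite !mulmxDl !ipE -!scalemxAl (tangential_skew kA) !ipE.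
  by rewrite (adjoint_J acs_sq acs_isom) mulNmx ipNr; ring.
set T := _ + _; pose z := P *m Z.
have ZE : Z = d *m z + a *: V := hyper_projE Z.
(* The tangential part of [V x X] is [- J X], so [T] is the tangential part
   of the cross product with the tangential vector [d z]. *)
have TE X : exists b, c (d *m (T *m X)) *m phi
    = c (d *m X) *m (c (d *m z) *m phi) + ip g z X *: phi - b *: (c V *m phi).
  exists (ip G (A *m (d *m X)) V).
  rewrite mulmxDl mulmxDr -!mulmxA -scalemxAl -scalemxAr (clD sm) (clZ sm) JE.
  have := congr1 (fun u => c u *m phi) (hyper_projE (A *m (d *m X))).
  rewrite (clD sm) (clZ sm) {1}AE (cl_cross sm xE) {1 2}ZE !ipE (clD sm) (clZ sm).
  rewrite mulmxDr -scalemxAr (ipC Gs V) dV mulr0 addr0 -ip_induced.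
  rewrite (clC sm (d *m X) V) dV mulr0 scale0r subr0 => E.
  by apply/colP => k; have := col_entry k E; rewrite !colsE; lra.
apply: mx_ext => X; apply/eqP; rewrite -subr_eq0 mulNmx opprK -!mulmxA.
apply/eqP; set Y := _ *m _ + _.
have [b E1] := TE X; have [b' E2] := TE (J *m X).
(* For the tangent vector [Y], [Y phi] is a combination of [phi] and [V phi]. Both are orthogonal to
   [X phi] for every tangent [X], so [Y phi] is orthogonal to itself. *)
have YE : c (d *m Y) *m phi
    = (b - ip g (J *m X) z) *: phi - (b' + ip g z X) *: (c V *m phi).
  rewrite /Y mulmxDr (clD sm) JE E1 E2.
  rewrite mulmxBr mulmxDr -!scalemxAr (clsq sm) V1.
  have F1 := clC sm (d *m (J *m X)) (d *m z) phi.
  rewrite JE (clC sm (d *m z) V) dV mulr0 scale0r subr0 -ip_induced in F1.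
  have F2 := congr1 (mulmx (c V)) (clC sm (d *m X) (d *m z) phi).
  rewrite mulmxBr mulmxN -scalemxAr -ip_induced in F2.
  apply/colP => k; have := col_entry k F1; have := col_entry k F2.
  rewrite !colsE !(ipC induced_sym z); lra.
have : ip H (c (d *m Y) *m phi) (c (d *m Y) *m phi) = 0.
  rewrite {1}YE !ipE (cl_phi0r sm) (cl_phi_isom sm) (ipC Gs) dV.
  by rewrite !mulr0 subrr.
rewrite (cl_phi_isom sm) => /(ip_eq0 Gp) dY0.
by apply: hyper_inj; rewrite dY0 mulmx0.
Qed.

End W4.

End ACS.

End Projection.

End Hyperplane.

(** * Product rules along a map *)

Lemma ip_sum (R : realType) r (G : 'M[R]_r) (I J : Type) (e : seq I)
    (e' : seq J) (a : I -> R) (b : J -> R) (F : I -> 'cV[R]_r) (F' : J -> 'cV[R]_r) :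
  ip G (\sum_(i <- e) a i *: F i) (\sum_(j <- e') b j *: F' j)
    = \sum_(i <- e) \sum_(j <- e') a i * b j * ip G (F i) (F' j).
Proof.
elim: e => [|i e IH]; first by rewrite !big_nil ip0l.
rewrite !big_cons ipDl IH; congr (_ + _).
elim: e' {IH} => [|j e' IH]; first by rewrite !big_nil ip0r.
by rewrite !big_cons ipDr IH ipZl ipZr mulrA.
Qed.

Section AlongMap.
Variables (R : realType) (n m : nat) (N : manifold R n) (M : manifold R m).
Variables (f : N -> M) (sf : smooth_map f).

(** [is_metric] speaks of sections over [M]. A section along [f] is locally a combination, with
    smooth coefficients, of pulled-back frame sections, so bilinearity transfers the smoothness;
    Clifford multiplication is treated in the same way. *)
Lemma smooth_along_metric r (E : vbundle M r) (h : M -> 'M[R]_r) p s t :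
  framed E -> is_metric idfun E h ->
  smooth_sec f E s p -> smooth_sec f E t p ->
  smooth_at (fun q => ip (h (f q)) (s q) (t q) : R^o) p.
Proof.
move=> fE [_ _ sh] ss st.
pose l i := local_frame E (f p) i.
have sl i : smooth_sec idfun E (l i) (f p) := local_frame_smooth fE (f p) i.
have sh' i j : smooth_at ((fun q => ip (h q) (l i q) (l j q) : R^o) \o f) p.
  by apply: (smooth_at_comp sf); exact: sh.
have := smooth_at_sum (index_enum 'I_r) (fun i => smooth_at_sum (index_enum 'I_r)
  (fun j => smooth_atM (smooth_atM (frame_coef_smooth i ss) (frame_coef_smooth j st))
    (sh' i j))).
apply: smooth_at_eq.
apply: filterS2 (near_frame_expand sf fE p s) (near_frame_expand sf fE p t).
by move=> q -> ->; rewrite ip_sum.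
Qed.

Lemma smooth_along_clifford r (T : vbundle M m) (E : vbundle M r)
    (c : M -> 'cV[R]_m -> 'M[R]_r) p X s :
  framed T -> framed E -> (forall q, linear (c q)) ->
  (forall q X s, smooth_sec idfun T X q -> smooth_sec idfun E s q ->
    smooth_sec idfun E (fun q => c q (X q) *m s q) q) ->
  smooth_sec f T X p -> smooth_sec f E s p ->
  smooth_sec f E (fun q => c (f q) (X q) *m s q) p.
Proof.
move=> fT fE cL sc sX ss.
pose k i := local_frame T (f p) i; pose l i := local_frame E (f p) i.
have sl i : smooth_sec idfun E (l i) (f p) := local_frame_smooth fE (f p) i.
have sk i : smooth_sec idfun T (k i) (f p) := local_frame_smooth fT (f p) i.
have skl i j : smooth_sec f E ((fun q => c q (k i q) *m l j q) \o f) p.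
  by apply: (smooth_sec_pull sf); exact: sc.
have := smooth_sec_sum (index_enum 'I_m) (fun i => smooth_sec_sum (index_enum 'I_r)
  (fun j => smooth_secZ (smooth_atM (frame_coef_smooth i sX) (frame_coef_smooth j ss))
    (skl i j))).
apply: smooth_sec_eq.
apply: filterS2 (near_frame_expand sf fT p X) (near_frame_expand sf fE p s).
move=> q EX Es; rewrite [in RHS]EX [in RHS]Es {EX Es}.
have cD a Y Z : c (f q) (a *: Y + Z) = a *: c (f q) Y + c (f q) Z := cL _ a Y Z.
have c0 : c (f q) 0 = 0.
  by have := cD (-1) 0 0; rewrite scaleN1r oppr0 addr0 scaleN1r addNr.
elim: index_enum => [|i e IH]; first by rewrite !big_nil c0 mul0mx.
rewrite !big_cons cD mulmxDl -IH; congr (_ + _).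
rewrite mulmx_sumr; apply: eq_bigr => j _.
by rewrite -scalemxAr -scalemxAl scalerA mulrC.
Qed.

(** [dmap f q] is written in the charts of [q] and [f q], which vary with [q]. The frames cancel
    this dependence: by the chain rule, what remains is the Jacobian of the single local expression
    of [f] at [p]. *)
Lemma dmap_smooth p Y : smooth_field Y p ->
  smooth_sec f (tangent M) (fun q => dmap f q *m Y q) p.
Proof.
move=> sY; have [_ sfp] := sf p.
have pp := cdom_self p; have fpp := cdom_self (f p).
pose Jf q := jac (chart (f p) \o f \o cinv p) (chart p q).
have sJ : smooth_at Jf p.
  have sJ' := smooth_near_jac sfp.
  apply: smooth_near_eq sJ'.
  have := near_cinv pp (near_cdom pp); apply: filterS => y [_ _ yK].
  by rewrite /Jf /= yK.
apply: smooth_at_eq (smooth_at_mulmx sJ sY).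
have nd : \forall q \near p, differentiable (chart (f p) \o f \o cinv p) (chart p q).
  exact: (near_chart pp (smooth_near_near sfp)).
apply: filterS3 nd (near_cdom pp) (near_vdom sf (@tangent_framed _ _ M) p).
move=> q dq pq fpq; have qq := cdom_self q; have fqq := cdom_self (f q).
have u1 := (@tangent_framed _ _ M).2 _ _ fpq.
have u2 := (@tangent_framed _ _ N).2 _ _ pq.
rewrite /= !mulmxA; congr (_ *m _); apply: (can_inj (mulKmx u1)).
rewrite mulmxA mulKVmx //; apply: (can_inj (mulmxK u2)); rewrite mulmxKV //.
have [_ /smooth_near_diff sfq] := sf q.
have E1 : (chart (f p) \o f \o cinv p) (chart p q) = chart (f p) (f q).
  by rewrite /= chartK.
have E2 : (chart q \o cinv p) (chart p q) = chart q q by rewrite /= chartK.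
have d1 := smooth_near_diff (chart_smooth fpq fqq).
have d2 := smooth_near_diff (chart_smooth pq qq).
rewrite -E1 in d1; rewrite -E2 in sfq.
rewrite /= -E1 -(jac_comp dq d1) /dmap -E2 -(jac_comp d2 sfq).
apply: jac_eq.
have H1 := near_cinv pq (near_map sf (near_cdom fpq)).
have H2 := near_cinv pq (near_cdom qq).
by apply: filterS2 H1 H2 => y [fy _ _] [qy _ _] /=; rewrite !chartK.
Qed.

(** Intended for the defect of a product rule: it is tensorial in both arguments, so a rule that
    holds for ambient sections extends to all sections along [f]. *)
Lemma bitensor_eq0 r1 r2 (E1 : vbundle M r1) (E2 : vbundle M r2)
    (U : lmodType R) (F : (N -> 'cV[R]_r1) -> (N -> 'cV[R]_r2) -> U) p :
  framed E1 -> framed E2 ->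
  (forall s, smooth_sec f E2 s p -> tensorial f E1 p (F^~ s)) ->
  (forall X, smooth_sec f E1 X p -> tensorial f E2 p (F X)) ->
  (forall (X : M -> _) (s : M -> _), smooth_sec idfun E1 X (f p) ->
    smooth_sec idfun E2 s (f p) -> F (X \o f) (s \o f) = 0) ->
  forall X s, smooth_sec f E1 X p -> smooth_sec f E2 s p -> F X s = 0.
Proof.
move=> f1 f2 T1 T2 F0 X s sX ss.
apply: (tensor_eq0 sf f2 (T2 X sX)) ss => t st.
apply: (tensor_eq0 sf f1 (T1 _ (smooth_sec_pull sf st))) sX => Y sY.
exact: F0.
Qed.

Lemma along_metric_rule r (E : vbundle M r) (h : M -> 'M[R]_r)
    (D : connection r M) p v F :
  framed E -> is_metric idfun E h -> metric_connection idfun E h D ->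
  derivation f E p v F ->
  (forall s : M -> _, smooth_sec idfun E s (f p) ->
    F (s \o f) = D (f p) (dmap f p *m v) s) ->
  forall s t, smooth_sec f E s p -> smooth_sec f E t p ->
  dir p v (fun q => ip (h (f q)) (s q) (t q))
    = ip (h (f p)) (F s) (t p) + ip (h (f p)) (s p) (F t).
Proof.
move=> fE hh [_ Dh] [FD FZ] FE s t ss st.
pose Bf s t : R^o := dir p v (fun q => ip (h (f q)) (s q) (t q))
  - (ip (h (f p)) (F s) (t p) + ip (h (f p)) (s p) (F t)).
have sh s' t' : smooth_sec f E s' p -> smooth_sec f E t' p ->
  smooth_at (fun q => ip (h (f q)) (s' q) (t' q) : R^o) p :=
  smooth_along_metric fE hh.
apply/eqP; rewrite -subr_eq0; apply/eqP.
apply: (bitensor_eq0 (F := Bf) fE fE) ss st => {s t}.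
- move=> t st; split=> [s s' ss ss'|a s sa ss]; rewrite /Bf.
    under [X in dir p v X]funext do rewrite ipDl.
    by rewrite dirD ?FD //; [rewrite !ipE; ring|exact: sh|exact: sh].
  under [X in dir p v X]funext do rewrite ipZl.
  rewrite (dirM v sa (sh _ _ ss st)) FZ //.
  by rewrite !ipE /GRing.scale /=; ring.
- move=> s ss; split=> [t t' st st'|a t sa st]; rewrite /Bf.
    under [X in dir p v X]funext do rewrite ipDr.
    by rewrite dirD ?FD //; [rewrite !ipE; ring|exact: sh|exact: sh].
  under [X in dir p v X]funext do rewrite ipZr.
  rewrite (dirM v sa (sh _ _ ss st)) FZ //.
  by rewrite !ipE /GRing.scale /=; ring.
move=> s t ss st; rewrite /Bf !FE // -Dh // -(dir_comp sf) ?subrr //.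
by case: hh => _ _; apply.
Qed.

Lemma along_clifford_rule r (T : vbundle M m) (E : vbundle M r)
    (c : M -> 'cV[R]_m -> 'M[R]_r) (D : connection m M) (DS : connection r M)
    p v FT FS :
  framed T -> framed E -> (forall q, linear (c q)) ->
  (forall q X s, smooth_sec idfun T X q -> smooth_sec idfun E s q ->
    smooth_sec idfun E (fun q => c q (X q) *m s q) q) ->
  (forall q w X s, smooth_sec idfun T X q -> smooth_sec idfun E s q ->
    DS q w (fun q => c q (X q) *m s q)
      = c q (D q w X) *m s q + c q (X q) *m DS q w s) ->
  derivation f T p v FT -> derivation f E p v FS ->
  (forall X : M -> _, smooth_sec idfun T X (f p) ->
    FT (X \o f) = D (f p) (dmap f p *m v) X) ->
  (forall s : M -> _, smooth_sec idfun E s (f p) ->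
    FS (s \o f) = DS (f p) (dmap f p *m v) s) ->
  forall X s, smooth_sec f T X p -> smooth_sec f E s p ->
  FS (fun q => c (f q) (X q) *m s q)
    = c (f p) (FT X) *m s p + c (f p) (X p) *m FS s.
Proof.
move=> fT fE cL sc Dc [FTD FTZ] [FSD FSZ] FTE FSE X s sX ss.
pose Bf X s := FS (fun q => c (f q) (X q) *m s q)
  - (c (f p) (FT X) *m s p + c (f p) (X p) *m FS s).
have sC X' s' : smooth_sec f T X' p -> smooth_sec f E s' p ->
    smooth_sec f E (fun q => c (f q) (X' q) *m s' q) p.
  exact: smooth_along_clifford.
have cD q Y Z : c q (Y + Z) = c q Y + c q Z by rewrite -[Y]scale1r cL !scale1r.
have c0 q : c q 0 = 0 by have := cD q 0 0; rewrite addr0 -{1}[c q 0]addr0 => /addrI.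
have cZ q a Y : c q (a *: Y) = a *: c q Y by rewrite -[_ *: Y]addr0 cL c0 addr0.
apply/eqP; rewrite -subr_eq0; apply/eqP.
apply: (bitensor_eq0 (F := Bf) fT fE) sX ss => {X s}.
- move=> s ss; split=> [X X' sX sX'|a X sa sX]; rewrite /Bf.
    under [X in FS X]funext do rewrite cD mulmxDl.
    rewrite FSD ?FTD //; [|exact: sC|exact: sC].
    by rewrite !cD !mulmxDl; apply/colP => k; rewrite !colsE; ring.
  under [X in FS X]funext do rewrite cZ -scalemxAl.
  rewrite FSZ ?FTZ //; last exact: sC.
  rewrite cD !cZ mulmxDl -!scalemxAl.
  by apply/colP => k; rewrite !colsE; ring.
- move=> X sX; split=> [s s' ss ss'|a s sa ss]; rewrite /Bf.
    under [X in FS X]funext do rewrite mulmxDr.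
    rewrite !FSD //; [|exact: sC|exact: sC].
    by rewrite !mulmxDr; apply/colP => k; rewrite !colsE; ring.
  under [X in FS X]funext do rewrite -scalemxAr.
  rewrite !FSZ //; last exact: sC.
  rewrite mulmxDr -!scalemxAr.
  by apply/colP => k; rewrite !colsE; ring.
move=> X s sX ss; rewrite /Bf FTE // FSE // -Dc // -FSE ?subrr //.
exact: sc.
Qed.

End AlongMap.

Lemma col_mulmx (R : pzSemiRingType) m n k (A : 'M[R]_(m, n)) (B : 'M[R]_(n, k)) j :
  col j (A *m B) = A *m col j B.
Proof. by apply/colP => i; rewrite !mxE; apply: eq_bigr => l _; rewrite mxE. Qed.

(** * Hypersurfaces *)

Section OrthonormalFrames.
Variable R : realType.

(** Gram-Schmidt by columns: a nonzero vector orthogonal to the columns already found is normalized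
    and appended. *)
Lemma orthonormal_ex n (G : 'M[R]_n) : G^T = G ->
  (forall u, u != 0 -> 0 < ip G u u) -> exists F, Defs.orthonormal G F.
Proof.
move=> Gs Gp.
suff H k : (k <= n)%N -> exists U : 'M[R]_(n, k), U^T *m G *m U = 1%:M.
  by have [U UE] := H n (leqnn n); exists U.
elim: k => [_|k IH kn].
  by exists 0; apply/matrixP => -[].
have [U UE] := IH (ltnW kn); rewrite -addn1.
have [X X0 UX] := orthogonal_ex G (fun i => col i U) kn.
have Xp := Gp _ X0; pose s := Num.sqrt (ip G X X).
have s0 : s != 0 by rewrite sqrtr_eq0 -ltNge.
have ss : s * s = ip G X X by rewrite -expr2 sqr_sqrtr // ltW.
exists (row_mx U (s^-1 *: X)).
have GUX : U^T *m (G *m X) = 0.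
  apply/colP => i; rewrite mulmxA [RHS]mxE -(UX i) /ip tr_col -!row_mul.
  by rewrite [RHS]mxE.
have GXU : X^T *m (G *m U) = 0.
  by apply: trmx_inj; rewrite !trmx_mul trmxK Gs -mulmxA GUX trmx0.
have trZ : (s^-1 *: X)^T = s^-1 *: X^T by rewrite linearZ.
rewrite tr_row_mx trZ -mulmxA mul_mx_row mul_col_row.
rewrite -!scalemxAr -!scalemxAl GUX GXU !scaler0 mulmxA UE.
rewrite scalar_mx_block; congr block_mx.
rewrite scalerA [_ *m _]mx11_scalar mulmxA -/(ip G X X) -ss scale_scalar_mx.
by rewrite mulrACA mulVf // mulr1.
Qed.

End OrthonormalFrames.

Lemma frame_prod_recr (R : realType) (c : 'cV[R]_7 -> 'M[R]_8)
    (B : 'M[R]_(7, 6)) (V : 'cV[R]_7) :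
  frame_prod c (row_mx B V : 'M[R]_(6 + 1)) = (\prod_(i < 6) c (col i B)) *m c V.
Proof.
rewrite /frame_prod big_ord_recr /=; congr (_ *m c _); last first.
  apply/colP => k; rewrite !mxE; case: splitP => j /= E; last by rewrite ord1.
  by have := ltn_ord j; rewrite -E.
apply: eq_bigr => i _; congr (c _); apply/colP => k; rewrite !mxE.
case: splitP => j /= E; first by congr (B _ _); apply: val_inj.
by have := ltn_ord i; rewrite E.
Qed.

Section HypersurfaceGeometry.
Variables (R : realType) (B : G2_manifold R) (M : hypersurface B).
Implicit Type p : M.

Let f := @hs_f R B M.
Let sf : smooth_map f := @hs_smooth R B M.
Let gP := @g2_gP R B.
Let spinP := @g2_spinP R B.
Let fT := @tangent_framed R 7 B.
Let fE := vbundle_framed (@g2_EP R B).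

Lemma hs_spinor_module p : spinor_module (g2_g (f p)) (g2_h (f p))
  (@g2_cl R B (f p)) (@g2_phi R B (f p)).
Proof.
have [gs gp _] := gP; have [[hs hp _] [cL cc cH _]] := spinP.
split; [exact: gs|exact: gp|exact: hs|exact: hp|exact: cL|exact: cc|exact: cH|].
by case: (g2_phiP (f p)).
Qed.

Let sm := hs_spinor_module.

Lemma hs_V1 p : ip (g2_g (f p)) (hs_V p) (hs_V p) = 1.
Proof. exact: hs_V_unit. Qed.

Lemma hs_dV p X : ip (g2_g (f p)) (hs_d p *m X) (hs_V p) = 0.
Proof. exact: hs_V_normal. Qed.

Lemma hs_drank p : \rank (hs_d p) = 6.
Proof. exact: hs_immersion. Qed.

Lemma hs_gE p X Y : ip (hs_g p) X Y = ip (g2_g (f p)) (hs_d p *m X) (hs_d p *m Y).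
Proof. exact: ip_induced. Qed.

Lemma hs_unit_spinor : unit_spinor f (g2_E B) (@hs_h R B M) (@hs_phi R B M).
Proof.
move=> p; have [sphi phi1] := g2_phiP (f p); split=> //.
exact: (smooth_sec_pull sf sphi).
Qed.

Lemma smooth_along_cl p X s : smooth_sec f (tangent B) X p ->
  smooth_sec f (g2_E B) s p ->
  smooth_sec f (g2_E B) (fun q => g2_cl (f q) (X q) *m s q) p.
Proof.
by case: spinP => _ [cL _ _ sc]; exact: smooth_along_clifford.
Qed.

Lemma smooth_hs_cl p X s : smooth_field X p -> smooth_sec f (g2_E B) s p ->
  smooth_sec f (g2_E B) (fun q => hs_cl q (X q) *m s q) p.
Proof.
move=> sX ss; have sdX := dmap_smooth sf sX.
have := smooth_along_cl (hs_V_smooth p) (smooth_along_cl sdX ss).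
by apply: smooth_near_ext => y /=; rewrite /hs_cl !mulmxA.
Qed.

Lemma hs_clE p X (u : 'cV[R]_8) :
  hs_cl p X *m u = g2_cl (f p) (hs_V p) *m (g2_cl (f p) (hs_d p *m X) *m u).
Proof. by rewrite mulmxA. Qed.

Lemma hs_spinor_bundle : spinor_bundle f (g2_E B) (@hs_g R B M) (@hs_h R B M)
  (@hs_cl R B M).
Proof.
have [hm [cL cc cH _]] := spinP; have [hs hp _] := hm.
split; first split=> [p|p|p s t ss st]; [exact: hs|exact: hp| |].
  exact: (smooth_along_metric sf fE hm).
split=> [p k X Y|p X|p X a b|p X s sX ss].
- by rewrite /hs_cl mulmxDr -scalemxAr cL mulmxDr -scalemxAr.
- apply: mx_ext => u.
  (* [V X V X = - V V X X = X X], since [X] is orthogonal to [V]. *)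
  rewrite -mulmxA !hs_clE (clC (sm p) (hs_d p *m X) (hs_V p)) hs_dV mulr0 scale0r.
  rewrite subr0 mulmxN !(clsq (sm p)) hs_V1 -hs_gE mul_scalar_mx.
  by rewrite scaleN1r opprK.
- rewrite !hs_clE (sm_skew (sm p)) (sm_skew (sm p)) opprK.
  by rewrite (clC (sm p) (hs_d p *m X) (hs_V p)) hs_dV mulr0 scale0r subr0 ipNr.
- exact: smooth_hs_cl.
Qed.

Lemma hs_orthonormal p F : Defs.orthonormal (hs_g p) F ->
  Defs.orthonormal (g2_g (f p)) (row_mx (hs_d p *m F) (hs_V p) : 'M[R]_(6 + 1)).
Proof.
move=> oF; rewrite /Defs.orthonormal; set A := hs_d p *m F; set V := hs_V p.
suff E : (row_mx A V)^T *m g2_g (f p) *m row_mx A V = 1%:M :> 'M[R]_(6 + 1).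
  exact: E.
rewrite tr_row_mx -mulmxA mul_mx_row mul_col_row {}/A {}/V.
have e1 : (hs_d p *m F)^T *m (g2_g (f p) *m (hs_d p *m F)) = 1%:M.
  by rewrite -oF /hs_g trmx_mul !mulmxA.
have e2 : (hs_d p *m F)^T *m (g2_g (f p) *m hs_V p) = 0.
  apply/colP => i; rewrite mulmxA [RHS]mxE -(hs_dV p (col i F)) -col_mulmx.
  by rewrite /ip tr_col -!row_mul [RHS]mxE.
have e3 : (hs_V p)^T *m (g2_g (f p) *m (hs_d p *m F)) = 0.
  apply: trmx_inj; rewrite trmx_mul (trmx_mul (g2_g _)) trmxK (sm_gC (sm p)).
  by rewrite -mulmxA e2 trmx0.
have e4 : (hs_V p)^T *m (g2_g (f p) *m hs_V p) = 1%:M.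
  by rewrite [LHS]mx11_scalar mulmxA -/(ip _ _ _) hs_V1.
by rewrite e1 e2 e3 e4 -scalar_mx_block.
Qed.

Lemma hs_is_j p : is_j p (g2_cl (f p) (hs_V p)).
Proof.
move=> F oF pF; have := g2_vol (hs_orthonormal oF) pF.
rewrite frame_prod_recr => E.
have {E} := congr1 (mulmx^~ (g2_cl (f p) (hs_V p))) E.
rewrite -mulmxA (sm_sq (sm p)) hs_V1 mul_mx_scalar scaleN1r mulNmx mul1mx.
move/oppr_inj => <-; apply: eq_bigr => i _.
by rewrite col_mulmx.
Qed.

(** [is_j] quantifies over positive orthonormal frames and would determine nothing if there were
    none. Exchanging two columns of an orthonormal frame corrects its orientation. *)
Lemma hs_positive_frame p : exists F, Defs.orthonormal (hs_g p) F /\ hs_positive p F.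
Proof.
have [F oF] := orthonormal_ex (induced_sym (sm p) (hs_d p))
  (induced_gt0 (sm p) (hs_drank p)).
have or0 := (g2_orP B).1 (f p).
pose D (F : 'M[R]_6) : R := \det (row_mx (hs_d p *m F) (hs_V p) : 'M[R]_(6 + 1)).
have D0 F' : Defs.orthonormal (hs_g p) F' -> D F' != 0.
  move=> /hs_orthonormal/(congr1 determinant); rewrite det1 !det_mulmx.
  move=> E; apply/eqP => D0; move: E; rewrite [X in _ * X]D0 mulr0 => /eqP.
  by rewrite eq_sym oner_eq0.
have [pF|nF] := boolP (0 < g2_or (f p) * D F); first by exists F.
pose s : 'M[R]_6 := tperm_mx ord0 (lift ord0 ord0).
have oFs : Defs.orthonormal (hs_g p) (F *m s).
  rewrite /Defs.orthonormal trmx_mul.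
  have -> : s^T *m F^T *m hs_g p *m (F *m s) = s^T *m (F^T *m hs_g p *m F) *m s.
    by rewrite !mulmxA.
  by rewrite oF mulmx1 tr_perm_mx -perm_mxM mulVg perm_mx1.
exists (F *m s); split=> //.
have DFs : D (F *m s) = - D F.
  have E : row_mx (hs_d p *m (F *m s)) (hs_V p)
      = row_mx (hs_d p *m F) (hs_V p) *m block_mx s 0 0 1%:M.
    by rewrite mul_row_block !mulmx0 addr0 add0r mulmx1 mulmxA.
  rewrite /D E det_mulmx det_ublock det1 mulr1 det_perm odd_tperm /=.
  by rewrite expr1 mulrN1.
rewrite /hs_positive /positive -/(D _) DFs mulrN oppr_gt0 lt_neqAle.
by rewrite mulf_neq0 ?D0 //= leNgt.
Qed.

Lemma is_jE p j : is_j p j -> j = g2_cl (f p) (hs_V p).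
Proof.
have [F [oF pF]] := hs_positive_frame p.
by move=> /(_ F oF pF) <-; exact: hs_is_j.
Qed.

End HypersurfaceGeometry.

Lemma g2_crossE (R : realType) (B : G2_manifold R) (p : B) X Y Z :
  ip (g2_g p) (g2_cross p X Y) Z = g2_Psi p X Y Z.
Proof.
have [gs gp _] := g2_gP B; have gu : g2_g p \in unitmx := gram_unit (gp p).
have [_ [cL _ _ _]] := g2_spinP B.
have PsiD k U U' : g2_Psi p X Y (k *: U + U') = k * g2_Psi p X Y U + g2_Psi p X Y U'.
  by rewrite /g2_Psi cL mulmxDl -scalemxAl !mulmxDr -!scalemxAr ipDl ipZl.
have Psi0 : g2_Psi p X Y 0 = 0.
  by have := PsiD 1 0 0; rewrite scaler0 addr0 mul1r -{1}[g2_Psi p X Y 0]addr0 => /addrI.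
rewrite (ipC (gs p)) /ip /g2_cross -mulmxA mulKVmx // mxE.
rewrite [in RHS](matrix_sum_delta Z).
transitivity (\sum_k Z k 0 * g2_Psi p X Y (delta_mx k 0)).
  by apply: eq_bigr => k _; rewrite !mxE.
elim: index_enum => [|k e IH]; first by rewrite !big_nil Psi0.
by rewrite !big_cons big_ord1 PsiD IH.
Qed.

(** * The Weingarten equation and the spinorial Gauss formula *)

Section GaussFormulas.
Variables (R : realType) (B : G2_manifold R).
Variables (Db : connection 7 B) (DbS : connection 8 B).
Hypothesis hDb : levi_civita (@g2_g R B) Db.
Hypothesis hDbS :
  spinor_lift idfun (g2_E B) (@g2_h R B) (@g2_cl R B) Db DbS.
Variables (M : hypersurface B) (DbT : connection 7 M) (D : connection 6 M).
Variables (DS : connection 8 M) (W : M -> 'M[R]_6).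
Hypothesis hDbT : is_pullback (@hs_f R B M) (tangent B) Db DbT.
Hypothesis hDS : spinor_lift (@hs_f R B M) (g2_E B) (@hs_h R B M)
  (@hs_cl R B M) D DS.
Hypothesis hW : weingarten DbT D W.
Variables (p : M) (v : 'cV[R]_6).

Let f := @hs_f R B M.
Let sf : smooth_map f := @hs_smooth R B M.
Let fT := @tangent_framed R 7 B.
Let fE := vbundle_framed (@g2_EP R B).
Let sm := hs_spinor_module p.
Let dDbT : derivation f (tangent B) p v (DbT p v) :=
  connection_derivation p v hDbT.1.

Lemma tangent_field_ex (X : 'cV[R]_6) :
  exists2 Y : M -> 'cV[R]_6, smooth_field Y p & Y p = X.
Proof. exact: (extend_vector (@tangent_framed R 6 M)). Qed.

(** Differentiating [g(V, V) = 1] kills the normal part of the difference [Z] of the two sides;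
    differentiating [g(V, Y) = 0] for tangent fields [Y] kills the tangential part by the Gauss
    formula. *)
Lemma normal_derivative : DbT p v (@hs_V R B M) = - (hs_d p *m (W p *m v)).
Proof.
have sV := @hs_V_smooth R B M p.
have rule := along_metric_rule sf fT (@g2_gP R B) hDb.1 dDbT (hDbT.2 p v).
apply/eqP; rewrite -subr_eq0 opprK; apply/eqP.
set Z := _ + _; have [X XE] := hyper_decomp (hs_drank p) (hs_V1 p) (hs_dV p) Z.
have ZV : ip (g2_g (f p)) Z (hs_V p) = 0.
  have := rule _ _ sV sV; under [X in dir p v X]funext do rewrite hs_V1.
  by rewrite dir_cst /Z ipDl hs_dV (ipC (sm_gC sm) (hs_V p)); lra.
rewrite XE ZV scale0r addr0; apply/eqP; apply: contraT => dX0.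
have := sm_g_gt0 sm dX0.
suff -> : ip (g2_g (f p)) (hs_d p *m X) (hs_d p *m X) = 0 by rewrite ltxx.
have {1}<- : Z = hs_d p *m X by rewrite [LHS]XE ZV scale0r addr0.
have [Y sY YX] := tangent_field_ex X.
have := rule _ _ sV (dmap_smooth sf sY).
under [X in dir p v X]funext do rewrite (ipC (sm_gC (hs_spinor_module _))) hs_dV.
rewrite dir_cst (hW.2 _ _ _ sY) ipDr ipZr hs_V1 mulr1 YX.
rewrite (ipC (sm_gC sm) _ (hs_d p *m D p v Y)) hs_dV add0r hs_gE.
by rewrite /Z ipDl => <-.
Qed.

(* The spinor lift [DS] is determined by [D]: its difference with the
   connection given by the spinorial Gauss formula is tensorial, skew, and
   commutes with the Clifford multiplication of the hypersurface. *)
Lemma spinor_gauss : DS p v (@hs_phi R B M)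
  = DbS (f p) (hs_d p *m v) (@g2_phi R B)
    + 2^-1 *: (g2_cl (f p) (hs_V p) *m
               (g2_cl (f p) (hs_d p *m (W p *m v)) *m hs_phi p)).
Proof.
have [[cDbS mDbS] clDbS] := hDbS; have [[cDS mDS] clDS] := hDS.
have [hm [cL _ _ csm]] := @g2_spinP R B.
have [FS [dFS FSE]] := pullback_derivation p v sf fE cDbS.
have dDS := connection_derivation p v cDS.
have mrule := along_metric_rule sf fE hm hDbS.1 dFS FSE.
have crule := along_clifford_rule sf fT fE cL csm clDbS dDbT dFS (hDbT.2 p v) FSE.
set V := hs_V p; set w := hs_d p *m (W p *m v); set c := g2_cl (f p).
pose F s := DS p v s - FS s - 2^-1 *: (c V *m (c w *m s p)).
have tF : tensorial f (g2_E B) p F.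
  split=> [s t ss st|a s sa ss]; rewrite /F.
    rewrite dDS.1 // dFS.1 // !mulmxDr.
    by apply/colP => k; rewrite !colsE; ring.
  rewrite dDS.2 // dFS.2 // -!scalemxAr.
  by apply/colP => k; rewrite !colsE; ring.
have [A AE] := tensor_mx sf fE tF.
have sec_ex u : exists2 s : M -> 'cV[R]_8, smooth_sec f (g2_E B) s p & s p = u.
  have [s ss <-] := extend_vector fE (f p) u.
  by exists (s \o f) => //; exact: smooth_sec_pull.
have wV : ip (g2_g (f p)) w V = 0 by exact: hs_dV.
have AV X (u : 'cV[R]_8) : ip (g2_g (f p)) X V = 0 ->
    A *m (c V *m (c X *m u)) = c V *m (c X *m (A *m u)).
  have [X0 ->] := hyper_decomp (hs_drank p) (hs_V1 p) (hs_dV p) X.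
  rewrite -/V !ipE hs_dV hs_V1 mulr1 add0r => ->; rewrite scale0r addr0.
  have [Y sY <-] := tangent_field_ex X0; have [s ss <-] := sec_ex u.
  set y := hs_d p *m Y p; set u' := s p.
  have sdY := dmap_smooth sf sY.
  have e1 : A *m (c V *m (c y *m u')) = F (fun q => hs_cl q (Y q) *m s q).
    by rewrite AE ?hs_clE //; exact: smooth_hs_cl.
  rewrite {}e1 -(AE s ss) /F clDS // !hs_clE -/V -/c -/y -/u'.
  have -> : FS (fun q => hs_cl q (Y q) *m s q) = FS (fun q =>
      g2_cl (f q) (hs_V q) *m (g2_cl (f q) (hs_d q *m Y q) *m s q)).
    by congr FS; apply/funext => q; rewrite hs_clE.
  have ss' := smooth_along_cl sdY ss.
  rewrite (crule _ _ (@hs_V_smooth R B M p) ss') (crule _ _ sdY ss).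
  (* The derivatives of [V] and of the tangent field leave [w y + g(w, y)], and the correction term
     leaves [(y w - w y) / 2]. The total [(w y + y w) / 2 + g(w, y)] is zero by the Clifford
     relation, which explains the factor [2^-1]. *)
  rewrite normal_derivative (hW.2 _ _ _ sY) hs_gE -/w -/y -/V -/c -/u'.
  rewrite (clN sm) (clD sm) (clZ sm) !(mulmxDr, mulmxN) -!scalemxAr.
  have cVV (u0 : 'cV[R]_8) : c V *m (c V *m u0) = - u0.
    by rewrite (clsq sm) hs_V1 scaleN1r.
  have E1 := congr1 (mulmx (c V)) (clC sm w V (c y *m u')).
  have E2 := congr1 (mulmx (c V)) (clC sm y V (c w *m u')).
  have E3 := clC sm y w u'.
  rewrite wV mulr0 scale0r subr0 mulmxN cVV in E1.
  rewrite [ip _ y V]hs_dV mulr0 scale0r subr0 mulmxN cVV in E2.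
  rewrite -/c E1 cVV E2; apply/colP => k; have := col_entry k E3.
  rewrite (ipC (sm_gC sm) y) !colsE; lra.
(* Both derivatives are metric, and [V w] is skew because [w] is orthogonal to [V]. *)
have Askew u t : ip (g2_h (f p)) (A *m u) t = - ip (g2_h (f p)) u (A *m t).
  have [s ss <-] := sec_ex u; have [s' ss' <-] := sec_ex t.
  have := mDS p v _ _ ss ss'; rewrite /hs_h (mrule _ _ ss ss').
  rewrite -!AE // /F !ipE !(sm_skew sm) (clC sm w V) wV mulr0 scale0r subr0 ipNr.
  lra.
have := skew_commutant sm (hs_V1 p) AV Askew.
have sphi := (hs_unit_spinor p).1.
rewrite -(AE _ sphi) /F => /eqP; rewrite subr_eq0 => /eqP/(canRL (subrK _)) ->.
by rewrite addrC; congr (_ + _); apply: FSE; case: (g2_phiP (f p)).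
Qed.

End GaussFormulas.

Theorem theorem5p5 (R : realType) (B : G2_manifold R) (a : g2_class)
    (* ambient Levi-Civita connection, its spinor lift, intrinsic endomorphism *)
    (Db : connection 7 B) (DbS : connection 8 B) (Sb : B -> 'M[R]_7)
    (hDb : levi_civita (@g2_g R B) Db)
    (hDbS : spinor_lift idfun (g2_E B) (@g2_h R B) (@g2_cl R B) Db DbS)
    (hSb : g2_intrinsic DbS Sb)
    (ha : forall p : B, in_g2_class a p (Sb p))
    (* hypersurface, its Levi-Civita connection, spinor lift, Weingarten map *)
    (M : hypersurface B)
    (DbT : connection 7 M) (D : connection 6 M) (DS : connection 8 M)
    (W : M -> 'M[R]_6)
    (hDbT : is_pullback (@hs_f R B M) (tangent B) Db DbT)
    (hD : levi_civita (@hs_g R B M) D)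
    (hDS : spinor_lift (@hs_f R B M) (g2_E B) (@hs_h R B M) (@hs_cl R B M) D DS)
    (hW : weingarten DbT D W) :
  [/\ spinor_bundle (@hs_f R B M) (g2_E B) (@hs_g R B M) (@hs_h R B M)
        (@hs_cl R B M),
      unit_spinor (@hs_f R B M) (g2_E B) (@hs_h R B M) (@hs_phi R B M),
      exists (J S : M -> 'M[R]_6) (eta : M -> 'rV[R]_6),
        [/\ almost_hermitian J, su3_J J & su3_intrinsic DS S eta] &
      forall (J S : M -> 'M[R]_6) (eta : M -> 'rV[R]_6),
        su3_J J -> su3_intrinsic DS S eta ->
        forall t : weingarten_type,
          (forall p : M, in_weingarten_type (hs_g p) (J p) t (W p)) ->
          forall p : M, in_su3_sum (hs_g p) (J p) (su3_table t a) (S p) (eta p)].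
Proof.
have gauss p v := spinor_gauss hDb hDbS hDbT hDS hW p v.
have proj (p : M) := hyper_proj_ex (hs_spinor_module p) (hs_drank p).
have acsP (J : M -> 'M[R]_6) : su3_J J <-> forall p, is_acs (g2_cl (hs_f p))
    (g2_phi (hs_f p)) (hs_d p) (hs_V p) (J p).
  split=> [HJ p X|HJ p j X /is_jE ->].
    have := HJ p _ X (hs_is_j (p := p)); rewrite !hs_clE.
    move/(congr1 (mulmx (g2_cl (hs_f p) (hs_V p)))).
    by rewrite !(clsq (hs_spinor_module p)) hs_V1 !scaleN1r => /oppr_inj.
  by rewrite !hs_clE HJ.
split; [exact: hs_spinor_bundle|exact: hs_unit_spinor| |].
- have acs (p : M) : exists J, is_acs (g2_cl (hs_f p)) (g2_phi (hs_f p))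
      (hs_d p) (hs_V p) J.
    have [P PE] := proj p.
    exact: (acs_ex (hs_spinor_module p) (hs_drank p) (hs_V1 p) (hs_dV p) PE).
  have [J JE] := choice acs.
  have tensors (p : M) : exists Q : 'M[R]_6 * 'rV[R]_6, forall X,
      DS p X (@hs_phi R B M)
        = (Q.2 *m X) 0 0 *: (g2_cl (hs_f p) (hs_V p) *m hs_phi p)
          + hs_cl p (Q.1 *m X) *m hs_phi p.
    have [P PE] := proj p; have sm := hs_spinor_module p.
    have [Phi PhiE] := cl_phi_mx sm.
    (* The Gauss formula as a linear map in [X]. Its values are orthogonal to [phi]; for the second
       term this holds because [W X] is tangent. *)
    pose N := Phi *m Sb (hs_f p) *m hs_d p
      + 2^-1 *: (g2_cl (hs_f p) (hs_V p) *m Phi *m hs_d p *m W p).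
    have NE X : DS p X (@hs_phi R B M) = N *m X.
      by rewrite gauss hSb mulmxDl -scalemxAl -!mulmxA !PhiE.
    have N0 X : ip (g2_h (hs_f p)) (N *m X) (g2_phi (hs_f p)) = 0.
      rewrite -NE gauss hSb ipDl ipZl (cl_phi0 sm) (sm_skew sm).
      by rewrite (cl_phi_isom sm) hs_dV oppr0 mulr0 addr0.
    have [S [eta E]] := su3_tensors_ex sm (hs_drank p) (hs_V1 p) (hs_dV p) PE (JE p) N0.
    by exists (S, eta) => X; rewrite NE E hs_clE.
  have [Q QE] := choice tensors.
  exists J, (fun p => (Q p).1), (fun p => (Q p).2); split.
  + move=> p; have sm := hs_spinor_module p; split.
      exact: (acs_sq sm (hs_drank p) (hs_V1 p) (JE p)).
    exact: (acs_isom sm (hs_V1 p) (JE p)).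
  + exact/acsP.
  + by move=> p j X /is_jE ->; exact: QE.
move=> J S eta /acsP JE HS t Wt p.
have sm := hs_spinor_module p; have [P PE] := proj p.
have J2 := acs_sq sm (hs_drank p) (hs_V1 p) (JE p).
have Jg := acs_isom sm (hs_V1 p) (JE p).
have [|-> etaE] := su3_tensorsE (S := S p) (W := W p) (eta := eta p)
  (A := Sb (hs_f p)) sm (hs_drank p) (hs_V1 p) (hs_dV p) PE (JE p).
  by move=> X; rewrite -hs_clE -(HS p _ X (hs_is_j (p := p))) gauss hSb.
rewrite -[eta p]addr0; apply: su3_sumD => //; last exact: weingarten_part.
have crossE := g2_crossE (hs_f p).
have := ha (hs_f p); case: a {ha} => /=.
- move=> [k SbE]; rewrite SbE.
  (* [Sb X = k X] has no normal component for tangent [X], so [eta] vanishes, as it must in the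
     column without [chi5]. *)
  have -> : eta p = 0.
    apply/rowP => i; have := etaE (delta_mx i 0).
    rewrite SbE mul_scalar_mx ipZl hs_dV mulr0 -colE mxE => ->.
    by rewrite mxE.
  have -> : P *m k%:M *m hs_d p = k%:M.
    apply: mx_ext => X; rewrite mul_mx_scalar -!scalemxAl -mulmxA mul_scalar_mx.
    by rewrite (hyper_projK sm (hs_drank p) PE).
  exact: su3_sum_W1.
- move=> der; apply: su3_sum_W2 => //.
  exact: (tangential_skew sm PE (derivation_skew sm crossE der)).
- move=> [Sbs _]; apply: su3_sum_W3 => //; exact: (tangential_sym sm PE Sbs).
- move=> [Z ZE].
  have [T [-> kT TJ]] := tangential_cross sm (hs_drank p) (hs_V1 p) (hs_dV p)
    PE (JE p) crossE ZE.
  exact: su3_sum_W4.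
Qed.
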